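(* Let $n\ge2$, let $X$ be a non-empty set, and let $B$ be the free right nilpotent skew brace of class at most $n$ on $X$, realised with additive group the free group $F_+(A_n)$, where $A_{n-1}\subseteq A_n=A_{n-1}\sqcup X^{(n)}$ are the sets defined in the context. Then $B/B^{(n)}$ is isomorphic to the free right nilpotent skew brace of class at most $n-1$ on $X$, and $$B^{(n)}=\langle a+b-a\mid b\in X^{(n)},\ a\in F_+(A_n)\rangle_+$$ is a trivial skew brace whose additive group is free, with free basis $\{a+b-a\mid a\in F_+(A_{n-1}),\ b\in X^{(n)}\}$.
   Context: A (left) skew brace is a triple $(B,+,\circ)$ with $(B,+)$ and $(B,\circ)$ groups such that $a\circ(b+c)=a\circ b-a+a\circ c$ for all $a,b,c$. It is trivial if $a\circ b=a+b$ for all $a,b$. Put $\lambda_a(b)=-a+a\circ b$, $a*b=\lambda_a(b)-b$. Put $B^{(1)}=B$ and let $B^{(k+1)}$ be the subgroup of $(B,+)$ generated by all $a*b$ with $a\in B^{(k)}$, $b\in B$ (these are ideals). $B$ is right nilpotent of class at most $n$ if $B^{(n+1)}=\{0\}$. The free right nilpotent skew brace of class at most $n$ on $X$ is the free object on $X$ in the category of these skew braces. $\langle S\rangle_+$ is the subgroup of $(B,+)$ generated by $S$. Realisation of the free object. For a set $T$, $F_+(T)$ and $F_\circ(T)$ denote the free group on $T$ written with operation $+$, resp. $\circ$; in $F_\circ(T)$ the inverse of $a$ is $\bar a$, and $\overline{T}=\{\bar a: a\in T\}$. Put $X^{(1)}=A_1=X$. Given $X^{(i)}\subseteq A_i$,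 let $F_{i+1}$ be the set of all $w\in F_\circ(A_i)$ whose reduced form is non-empty and ends with a letter of $X^{(i)}\cup\overline{X^{(i)}}$; let $X^{(i+1)}$ be the set of (new, pairwise distinct) symbols $x^{(i+1)}_{f,t}$ with $f\in F_{i+1}$, $t\in A_i$, and $A_{i+1}=A_i\sqcup X^{(i+1)}$. For $c\in A_n$ let $k(c)$ be the integer with $c\in X^{(k(c))}$, and $k(\bar c)=k(c)$. For $a\in A_n\cup\overline{A_n}$ define an endomorphism $\lambda_a$ of $F_+(A_n)$: if $k(a)=n$, $\lambda_a=\mathrm{id}$; if $k(a)<n$, then for $b\in A_n$: (i) $\lambda_a(b)=x^{(k(a)+1)}_{a,b}+b$ if $k(a)\ge k(b)$; (ii) $\lambda_a(b)=x^{(k(b))}_{a\circ f,t}$ if $k(a)<k(b)$, $b=x^{(k(b))}_{f,t}$, $f\ne\bar a$; (iii) $\lambda_a(b)=-x^{(k(b))}_{a,t}$ if $k(a)<k(b)$, $b=x^{(k(b))}_{f,t}$, $f=\bar a$ (with $\overline{\bar c}=c$). This induces a homomorphism $\lambda\colon F_\circ(A_n)\to\mathrm{Aut}(F_+(A_n))$, and the $1$-cocycle $\pi\colon F_\circ(A_n)\to F_+(A_n)$, $\pi(u\circ v)=\pi(u)+\lambda_u(\pi(v))$, with $\pi(a)=a$ for $a\in A_n$, is bijective. $B$ is $F_+(A_n)$ with multiplication $u\circ v=\pi(\pi^{-1}(u)\circ\pi^{-1}(v))$; with the inclusion $X\subseteq A_n$ it is the free right nilpotent skew brace of class at most $n$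 on $X$. *)

(* Defs.v *)
From mathcomp Require Import all_boot.
From mathcomp Require Import boolp classical_sets.

Set Implicit Arguments.
Unset Strict Implicit.
Unset Printing Implicit Defensive.

Declare Scope brace_scope.
Delimit Scope brace_scope with B.
Local Open Scope classical_set_scope.
Local Open Scope brace_scope.

(* Groups are written additively, although they need not be commutative. *)

Record is_group (T : Type) (op : T -> T -> T) (e : T) (inv : T -> T) : Prop :=
  IsGroup {
    is_groupA : associative op;
    is_group1l : left_id e op;
    is_group1r : right_id e op;
    is_groupVl : left_inverse e inv op;
    is_groupVr : right_inverse e inv op }.

Record group := Group {
  group_sort :> Type;
  gadd : group_sort -> group_sort -> group_sort;
  gzero : group_sort;
  gopp : group_sort -> group_sort;
  groupP : is_group gadd gzero gopp }.
Arguments gzero {_}.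

Notation "x + y" := (gadd x y) : brace_scope.
Notation "0" := gzero : brace_scope.
Notation "- x" := (gopp x) : brace_scope.
Notation "x - y" := (gadd x (gopp y)) : brace_scope.

Section GroupTheory.
Variable G : group.
Implicit Types x y z : G.

Lemma gA x y z : x + (y + z) = x + y + z.
Proof. exact: is_groupA (groupP G) x y z. Qed.
Lemma g0l x : 0 + x = x. Proof. exact: is_group1l (groupP G) x. Qed.
Lemma g0r x : x + 0 = x. Proof. exact: is_group1r (groupP G) x. Qed.
Lemma gNl x : - x + x = 0. Proof. exact: is_groupVl (groupP G) x. Qed.
Lemma gNr x : x - x = 0. Proof. exact: is_groupVr (groupP G) x. Qed.
Lemma gK x y : x + y - y = x. Proof. by rewrite -gA gNr g0r. Qed.
Lemma gNK x y : x - y + y = x. Proof. by rewrite -gA gNl g0r. Qed.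
Lemma gIr x y z : x + z = y + z -> x = y.
Proof. by move=> h; rewrite -(gK x z) h gK. Qed.
Lemma gIl x y z : z + x = z + y -> x = y.
Proof. by move=> h; rewrite -[x]g0l -(gNl z) -gA h gA gNl g0l. Qed.
Lemma gN_uniq x y : x + y = 0 -> - x = y.
Proof. by move=> h; apply: (@gIl _ _ x); rewrite h gNr. Qed.
Lemma gNN x : - - x = x. Proof. by apply: gN_uniq; rewrite gNl. Qed.
Lemma gND x y : - (x + y) = - y - x.
Proof. by apply: gN_uniq; rewrite gA gK gNr. Qed.
Lemma gN0 : - (0 : G) = 0. Proof. by apply: gN_uniq; rewrite g0l. Qed.

Definition gsimp := (gND, gNN, gN0, gA, gK, gNK, gNl, gNr, g0l, g0r).

End GroupTheory.

Inductive generated (G : group) (S : set G) : G -> Prop :=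
| generated_in x : S x -> generated S x
| generated0 : generated S 0
| generatedD x y : generated S x -> generated S y -> generated S (x + y)
| generatedN x : generated S x -> generated S (- x).

Record skew_brace := SkewBrace {
  additive_group :> group;
  circ : additive_group -> additive_group -> additive_group;
  cone : additive_group;
  cinv : additive_group -> additive_group;
  circP : is_group circ cone cinv;
  circDr : forall a b c, circ a (b + c) = circ a b - a + circ a c }.
Arguments cone {_}.

Notation "x ∘ y" := (circ x y) (at level 40, left associativity) : brace_scope.

Definition lambda (B : skew_brace) (a b : B) : B := - a + a ∘ b.
Definition star (B : skew_brace) (a b : B) : B := lambda a b - b.

Definition is_trivial (B : skew_brace) := forall a b : B, a ∘ b = a + b.

(* [right_series B k] is B^(k) for k >= 1; the index 0 is not used. *)
Definition right_series (B : skew_brace) (k : nat) : set B :=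
  iter k.-1
    (fun I : set B => generated [set x | exists a b, I a /\ x = star a b])
    [set: B].
Arguments right_series : clear implicits.

Definition right_nilpotent (n : nat) (B : skew_brace) :=
  right_series B n.+1 = [set 0].

Definition is_brace_hom (B C : skew_brace) (f : B -> C) :=
  (forall a b, f (a + b) = f a + f b) /\ (forall a b, f (a ∘ b) = f a ∘ f b).

Definition isomorphic (B C : skew_brace) :=
  exists f : B -> C, is_brace_hom f /\ bijective f.

Definition is_free_right_nilpotent (n : nat) (X : Type) (F : skew_brace)
    (i : X -> F) :=
  right_nilpotent n F /\
  forall (C : skew_brace) (f : X -> C), right_nilpotent n C ->
    exists phi : F -> C,
      [/\ is_brace_hom phi, forall x, phi (i x) = f x &
          forall psi : F -> C, is_brace_hom psi ->
            (forall x, psi (i x) = f x) -> psi = phi].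

Record is_ideal (B : skew_brace) (I : set B) : Prop := IsIdeal {
  ideal0 : I 0;
  idealD : forall x y, I x -> I y -> I (x + y);
  idealN : forall x, I x -> I (- x);
  ideal_conj : forall a x, I x -> I (a + x - a);
  ideal_lambda : forall a x, I x -> I (lambda a x);
  ideal_cconj : forall a x, I x -> I (a ∘ x ∘ cinv a) }.

Section BraceTheory.
Variable B : skew_brace.
Implicit Types a b c x y : B.

Lemma lambdaE a b : lambda a b = - a + a ∘ b. Proof. by []. Qed.
Lemma starE a b : star a b = lambda a b - b. Proof. by []. Qed.

Lemma cA a b c : a ∘ (b ∘ c) = a ∘ b ∘ c.
Proof. exact: is_groupA (circP B) a b c. Qed.
Lemma c1l a : cone ∘ a = a. Proof. exact: is_group1l (circP B) a. Qed.
Lemma c1r a : a ∘ cone = a. Proof. exact: is_group1r (circP B) a. Qed.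
Lemma cVl a : cinv a ∘ a = cone. Proof. exact: is_groupVl (circP B) a. Qed.
Lemma cVr a : a ∘ cinv a = cone. Proof. exact: is_groupVr (circP B) a. Qed.
Lemma cKr a b : a ∘ b ∘ cinv b = a. Proof. by rewrite -cA cVr c1r. Qed.
Lemma cKVr a b : a ∘ cinv b ∘ b = a. Proof. by rewrite -cA cVl c1r. Qed.
Lemma cV_uniq a b : a ∘ b = cone -> cinv a = b.
Proof. by move=> h; rewrite -[LHS]c1r -h cA cVl c1l. Qed.

Lemma c0r a : a ∘ 0 = a.
Proof.
have := circDr a 0 0; rewrite g0l -gA => h.
have {}h : - a + a ∘ 0 = 0 by apply: (@gIl _ _ _ (a ∘ 0)); rewrite g0r.
by apply: (@gIl _ _ _ (- a)); rewrite h gNl.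
Qed.

Lemma cone0 : cone = 0 :> B.
Proof. by rewrite -(c0r cone) c1l. Qed.

Lemma circE a b : a ∘ b = a + lambda a b.
Proof. by rewrite lambdaE !gsimp. Qed.

Lemma lambdaD a b c : lambda a (b + c) = lambda a b + lambda a c.
Proof. by rewrite lambdaE circDr !gA. Qed.

Lemma lambda0 a : lambda a 0 = 0.
Proof. by rewrite lambdaE c0r gNl. Qed.

Lemma lambdaN a b : lambda a (- b) = - lambda a b.
Proof. by apply/esym/gN_uniq; rewrite -lambdaD gNr lambda0. Qed.

Lemma lambdaM a b c : lambda (a ∘ b) c = lambda a (lambda b c).
Proof.
by rewrite [lambda b c]lambdaE lambdaD lambdaN !lambdaE cA !gsimp.
Qed.

Lemma lambda1 b : lambda cone b = b.
Proof. by rewrite lambdaE c1l cone0 gN0 g0l. Qed.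

Lemma lambdaK a b : lambda a (lambda (cinv a) b) = b.
Proof. by rewrite -lambdaM cVr lambda1. Qed.

Lemma lambdaVK a b : lambda (cinv a) (lambda a b) = b.
Proof. by rewrite -lambdaM cVl lambda1. Qed.

Lemma cinvE a : cinv a = - lambda (cinv a) a.
Proof. by rewrite lambdaE cVl cone0 g0r gNN. Qed.

Lemma lambda_cinv a : lambda a (cinv a) = - a.
Proof. by rewrite lambdaE cVr cone0 g0r. Qed.

Section IdealTheory.
Variables (I : set B) (hI : is_ideal I).

Lemma ideal_circ x y : I x -> I y -> I (x ∘ y).
Proof. by move=> Ix Iy; rewrite circE; apply/(idealD hI)/(ideal_lambda hI). Qed.

Lemma ideal_cinv x : I x -> I (cinv x).
Proof. by move=> Ix; rewrite cinvE; apply/(idealN hI)/(ideal_lambda hI). Qed.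

Lemma ideal_conjN a x : I x -> I (- a + x + a).
Proof. by move=> Ix; have := ideal_conj hI (- a) Ix; rewrite gNN. Qed.

Lemma ideal_star x b : I x -> I (star x b).
Proof.
move=> Ix.
have Iz : I (cinv b ∘ x ∘ b).
  have := ideal_cconj hI (cinv b) Ix.
  suff -> : cinv (cinv b) = b by [].
  by apply: cV_uniq; rewrite cVl.
have e : x ∘ b = b + lambda b (cinv b ∘ x ∘ b).
  by rewrite -circE !cA cVr c1l.
have -> : star x b = - x + (b + lambda b (cinv b ∘ x ∘ b) - b).
  by rewrite starE [lambda x b]lambdaE e !gA.
apply: (idealD hI); first exact: (idealN hI).
exact: (ideal_conj hI) (ideal_lambda hI _ Iz).
Qed.

End IdealTheory.

Lemma ideal_next (I : set B) : is_ideal I ->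
  is_ideal (generated [set x | exists a b, I a /\ x = star a b]).
Proof.
move=> hI; set S := [set x | _].
have conjS a x : generated S x -> generated S (a + x - a).
  elim=> {x}[x [c [b [Ic ->]]]||x y _ hx _ hy|x _ hx].
  - have -> : a + star c b - a = - star c a + star c (a + b).
      by rewrite !starE lambdaD !gsimp.
    apply: generatedD; first apply: generatedN; apply: generated_in.
      by exists c, a.
    by exists c, (a + b).
  - by rewrite !gsimp; exact: generated0.
  - have -> : a + (x + y) - a = (a + x - a) + (a + y - a) by rewrite !gsimp.
    exact: generatedD.
  - have -> : a - x - a = - (a + x - a) by rewrite !gsimp.
    exact: generatedN.
have lamS a x : generated S x -> generated S (lambda a x).
  elim=> {x}[x [c [b [Ic ->]]]||x y _ hx _ hy|x _ hx].
  - apply: generated_in; exists (a ∘ c ∘ cinv a), (lambda a b).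
    split; first exact: ideal_cconj.
    by rewrite !starE lambdaD lambdaN !lambdaM lambdaVK.
  - by rewrite lambda0; exact: generated0.
  - by rewrite lambdaD; exact: generatedD.
  - by rewrite lambdaN; exact: generatedN.
have SI x : generated S x -> I x.
  elim=> {x}[x [c [b [Ic ->]]]||x y _ hx _ hy|x _ hx].
  - exact: ideal_star.
  - exact: ideal0 hI.
  - exact: (idealD hI).
  - exact: (idealN hI).
split=> //.
- exact: generated0.
- by move=> *; exact: generatedD.
- by move=> *; exact: generatedN.
- move=> a x Sx; rewrite -cA circE [x ∘ _]circE.
  have -> : lambda x (cinv a) = star x (cinv a) + cinv a.
    by rewrite starE gNK.
  rewrite (lambdaD a x) (lambdaD a (star x _)) lambda_cinv.
  have : generated S (lambda a x) by exact: lamS.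
  have : generated S (lambda a (star x (cinv a))).
    by apply/lamS/generated_in; exists x, (cinv a); split=> //; exact: SI.
  move: (lambda a x) (lambda a _) => y z Sz Sy.
  by rewrite !gA -(gA a); apply: conjS; exact: generatedD.
Qed.

Lemma right_series_ideal k : is_ideal (right_series B k).
Proof.
rewrite /right_series; elim: k.-1 => [|m IHm] /=; first by split.
exact: ideal_next.
Qed.

End BraceTheory.

Section Quotient.
Variables (B : skew_brace) (I : set B) (hI : is_ideal I).

Definition coset (a : B) : set B := [set y | exists2 x, I x & y = a + x].

Definition quotient_type := {S : set B | exists a, S = coset a}.

Definition quotient_proj (a : B) : quotient_type :=
  exist _ (coset a) (ex_intro _ a erefl).

Definition quotient_repr (S : quotient_type) : B := sval (cid (svalP S)).

Definition quotient_add (S T : quotient_type) :=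
  quotient_proj (quotient_repr S + quotient_repr T).
Definition quotient_opp (S : quotient_type) :=
  quotient_proj (- quotient_repr S).
Definition quotient_circ (S T : quotient_type) :=
  quotient_proj (quotient_repr S ∘ quotient_repr T).
Definition quotient_cinv (S : quotient_type) :=
  quotient_proj (cinv (quotient_repr S)).

Lemma quotient_reprK S : quotient_proj (quotient_repr S) = S.
Proof.
rewrite /quotient_repr; case: (cid _) => a /= Sa.
case: S Sa => S hS /= Sa; subst S; congr exist; exact: Prop_irrelevance.
Qed.

Lemma quotient_projP a b :
  quotient_proj a = quotient_proj b <-> exists2 x, I x & b = a + x.
Proof.
split=> [|[x Ix ->]].
  move=> /(congr1 (@sval _ _)) /= h.
  suff : coset b b by rewrite -h.
  by exists 0; [exact: ideal0 hI | rewrite g0r].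
have h : coset a = coset (a + x).
  apply/seteqP; split=> y [z Iz ->].
    exists (- x + z); last by rewrite !gsimp.
    by apply/(idealD hI) => //; exact: (idealN hI).
  by exists (x + z); [exact: (idealD hI) | rewrite !gsimp].
rewrite /quotient_proj; move: (ex_intro _ (a + x) _); rewrite -h => p.
congr exist; exact: Prop_irrelevance.
Qed.

Lemma quotient_projK a : exists2 x, I x & quotient_repr (quotient_proj a) = a + x.
Proof. by apply/quotient_projP; rewrite quotient_reprK. Qed.

Lemma quotient_addE a b :
  quotient_add (quotient_proj a) (quotient_proj b) = quotient_proj (a + b).
Proof.
have [x Ix ex] := quotient_projK a; have [y Iy ey] := quotient_projK b.
rewrite /quotient_add ex ey; apply/esym/quotient_projP.
exists (- b + x + b + y); last by rewrite !gsimp.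
by apply/(idealD hI) => //; exact: ideal_conjN.
Qed.

Lemma quotient_oppE a : quotient_opp (quotient_proj a) = quotient_proj (- a).
Proof.
have [x Ix ex] := quotient_projK a.
rewrite /quotient_opp ex; apply/esym/quotient_projP.
exists (a - x - a); last by rewrite !gsimp.
exact/(ideal_conj hI)/(idealN hI).
Qed.

Lemma ideal_add_circ a x : I x -> exists2 x', I x' & a + x = a ∘ x'.
Proof.
move=> Ix; exists (lambda (cinv a) x); first exact: (ideal_lambda hI).
by rewrite circE lambdaK.
Qed.

Lemma ideal_circ_add a x : I x -> exists2 x', I x' & a ∘ x = a + x'.
Proof.
by move=> Ix; exists (lambda a x); [exact: (ideal_lambda hI) | rewrite circE].
Qed.

Lemma ideal_cconjV a x : I x -> I (cinv a ∘ x ∘ a).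
Proof.
move=> Ix; have := ideal_cconj hI (cinv a) Ix.
suff -> : cinv (cinv a) = a by [].
by apply: cV_uniq; rewrite cVl.
Qed.

Lemma quotient_circE a b :
  quotient_circ (quotient_proj a) (quotient_proj b) = quotient_proj (a ∘ b).
Proof.
have [x Ix ex] := quotient_projK a; have [y Iy ey] := quotient_projK b.
rewrite /quotient_circ ex ey; apply/esym/quotient_projP.
have [{ex}x' Ix' ->] := ideal_add_circ a Ix.
have [{ey}y' Iy' ->] := ideal_add_circ b Iy.
have -> : a ∘ x' ∘ (b ∘ y') = a ∘ b ∘ (cinv b ∘ x' ∘ b ∘ y').
  by rewrite !cA cKr.
by apply: ideal_circ_add; apply: (ideal_circ hI) => //; exact: ideal_cconjV.
Qed.

Lemma quotient_cinvE a : quotient_cinv (quotient_proj a) = quotient_proj (cinv a).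
Proof.
have [x Ix ex] := quotient_projK a.
rewrite /quotient_cinv ex; apply/esym/quotient_projP.
have [{ex}x' Ix' ->] := ideal_add_circ a Ix.
have -> : cinv (a ∘ x') = cinv a ∘ (a ∘ cinv x' ∘ cinv a).
  by apply: cV_uniq; rewrite !cA cKVr cKr cVr.
by apply/ideal_circ_add/(ideal_cconj hI)/(ideal_cinv hI).
Qed.

Lemma quotient_addP :
  is_group quotient_add (quotient_proj 0) quotient_opp.
Proof.
split.
- move=> S T U; rewrite -(quotient_reprK S) -(quotient_reprK T) -(quotient_reprK U).
  by rewrite !quotient_addE gA.
- by move=> S; rewrite -(quotient_reprK S) !quotient_addE g0l.
- by move=> S; rewrite -(quotient_reprK S) !quotient_addE g0r.
- by move=> S; rewrite -(quotient_reprK S) quotient_oppE !quotient_addE gNl.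
- by move=> S; rewrite -(quotient_reprK S) quotient_oppE !quotient_addE gNr.
Qed.

Lemma quotient_circP :
  is_group quotient_circ (quotient_proj cone) quotient_cinv.
Proof.
split.
- move=> S T U; rewrite -(quotient_reprK S) -(quotient_reprK T) -(quotient_reprK U).
  by rewrite !quotient_circE cA.
- by move=> S; rewrite -(quotient_reprK S) !quotient_circE c1l.
- by move=> S; rewrite -(quotient_reprK S) !quotient_circE c1r.
- by move=> S; rewrite -(quotient_reprK S) quotient_cinvE !quotient_circE cVl.
- by move=> S; rewrite -(quotient_reprK S) quotient_cinvE !quotient_circE cVr.
Qed.

Lemma quotient_circDr (S T U : quotient_type) :
  quotient_circ S (quotient_add T U) =
  quotient_add (quotient_add (quotient_circ S T) (quotient_opp S))
               (quotient_circ S U).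
Proof.
rewrite -(quotient_reprK S) -(quotient_reprK T) -(quotient_reprK U).
by rewrite quotient_oppE !(quotient_addE, quotient_circE) circDr.
Qed.

Definition quotient_brace : skew_brace :=
  @SkewBrace (Group quotient_addP) _ _ _ quotient_circP quotient_circDr.

End Quotient.

Section IdealBrace.
Variables (B : skew_brace) (I : set B) (hI : is_ideal I).

Let IB := {x : B | I x}.
Let inI (x : B) (Ix : I x) : IB := exist _ x Ix.

Lemma ideal_val_inj (x y : IB) : sval x = sval y -> x = y.
Proof.
case: x y => x Ix [y Iy] /= e; subst y; congr exist; exact: Prop_irrelevance.
Qed.

Definition ideal_add (x y : IB) : IB := inI (idealD hI (svalP x) (svalP y)).
Definition ideal_opp (x : IB) : IB := inI (idealN hI (svalP x)).
Definition ideal_mul (x y : IB) : IB := inI (ideal_circ hI (svalP x) (svalP y)).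
Definition ideal_inv (x : IB) : IB := inI (ideal_cinv hI (svalP x)).

Lemma ideal_one : I cone.
Proof. by rewrite cone0; exact: ideal0 hI. Qed.

Lemma ideal_addP : is_group ideal_add (inI (ideal0 hI)) ideal_opp.
Proof.
split; repeat move=> ?; apply: ideal_val_inj => /=.
- exact: gA.
- exact: g0l.
- exact: g0r.
- exact: gNl.
- exact: gNr.
Qed.

Lemma ideal_mulP : is_group ideal_mul (inI ideal_one) ideal_inv.
Proof.
split; repeat move=> ?; apply: ideal_val_inj => /=.
- exact: cA.
- exact: c1l.
- exact: c1r.
- exact: cVl.
- exact: cVr.
Qed.

Lemma ideal_mulDr (x y z : IB) :
  ideal_mul x (ideal_add y z) =
  ideal_add (ideal_add (ideal_mul x y) (ideal_opp x)) (ideal_mul x z).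
Proof. by apply: ideal_val_inj; exact: circDr. Qed.

Definition ideal_brace : skew_brace :=
  @SkewBrace (Group ideal_addP) _ _ _ ideal_mulP ideal_mulDr.

End IdealBrace.

(* The letter [(c, false)] is the generator [c] and [(c, true)] its inverse. *)
Definition letter_inv (T : Type) (l : T * bool) : T * bool := (l.1, ~~ l.2).

Definition reduced (T : Type) (w : seq (T * bool)) : bool :=
  sorted (fun l m => ~~ `[< m = letter_inv l >]) w.

(* The reduced form of [l :: w], for [w] reduced. *)
Definition push (T : Type) (l : T * bool) (w : seq (T * bool)) :=
  if w is m :: w' then if `[< m = letter_inv l >] then w' else l :: w
  else [:: l].

Section FreeGroup.
Variable T : Type.
Implicit Types (l m : T * bool) (u v w : seq (T * bool)).

Lemma letter_invK l : letter_inv (letter_inv l) = l.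
Proof. by case: l => c e; rewrite /letter_inv /= negbK. Qed.

Lemma reduced_cons l m w :
  reduced [:: l, m & w] = ~~ `[< m = letter_inv l >] && reduced (m :: w).
Proof. by []. Qed.

Lemma reduced_behead l w : reduced (l :: w) -> reduced w.
Proof. by case: w => // m w; rewrite reduced_cons => /andP[]. Qed.

Lemma reduced_cat u l v :
  reduced (u ++ l :: v) = reduced (rcons u l) && reduced (l :: v).
Proof.
case: u => [|m u] //=; rewrite /reduced /= cat_path rcons_path /=.
by rewrite -andbA.
Qed.

Lemma pushE l w : reduced (l :: w) -> push l w = l :: w.
Proof. by case: w => // m w; rewrite reduced_cons /= => /andP[/negbTE->]. Qed.

Lemma push_reduced l w : reduced w -> reduced (push l w).
Proof.
case: w => // m w rw /=; case: ifPn => // h; first exact: reduced_behead rw.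
by rewrite reduced_cons h.
Qed.

Lemma pushK l w : reduced w -> push (letter_inv l) (push l w) = w.
Proof.
case: w => [|m w] rw /=; first by rewrite letter_invK asboolT.
case: ifPn => [/asboolP e|h]; last by rewrite /= letter_invK asboolT.
by subst m; rewrite pushE.
Qed.

Lemma pushKV l w : reduced w -> push l (push (letter_inv l) w) = w.
Proof. by move=> rw; rewrite -{1}(letter_invK l) pushK. Qed.

Definition free_type := {w : seq (T * bool) | reduced w}.

Lemma foldr_push_reduced u v : reduced v -> reduced (foldr (@push T) v u).
Proof. by move=> rv; elim: u => //= l u; exact: push_reduced. Qed.

Definition free_mul (u v : free_type) : free_type :=
  exist _ (foldr (@push T) (val v) (val u)) (foldr_push_reduced _ (valP v)).

Definition free_one : free_type := exist _ [::] isT.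

Definition word_inv w := rev (map (@letter_inv T) w).

Lemma word_inv_reduced w : reduced w -> reduced (word_inv w).
Proof.
rewrite /word_inv /reduced rev_sorted sorted_map.
case: w => // l w /= h; rewrite (eq_path (e' := fun l m => ~~ `[< m = letter_inv l >])) //.
move=> x y /=; congr (~~ _); apply: asbool_equiv_eq; rewrite letter_invK.
by split=> [->|->]; rewrite ?letter_invK.
Qed.

Definition free_inv (u : free_type) : free_type :=
  exist _ (word_inv (val u)) (word_inv_reduced (valP u)).

Definition free_push l (u : free_type) : free_type :=
  exist _ (push l (val u)) (push_reduced l (valP u)).

Lemma foldr_pushM l u w : reduced u -> reduced w ->
  foldr (@push T) w (push l u) = push l (foldr (@push T) w u).
Proof.
case: u => // m u ru rw /=; case: ifPn => //= /asboolP->.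
by rewrite pushKV // foldr_push_reduced.
Qed.

Lemma foldr_push_nil w : reduced w -> foldr (@push T) [::] w = w.
Proof.
by elim: w => //= l w IHw rw; rewrite IHw ?pushE //; exact: reduced_behead rw.
Qed.

Lemma foldr_push_inv w : reduced w -> foldr (@push T) w (word_inv w) = [::].
Proof.
elim: w => // l w IHw rw; rewrite /word_inv /= rev_cons foldr_rcons.
rewrite -[l :: w](pushE rw) pushK; last exact: reduced_behead rw.
by apply: IHw; exact: reduced_behead rw.
Qed.

Lemma word_invK w : word_inv (word_inv w) = w.
Proof.
rewrite /word_inv map_rev revK -map_comp -[RHS]map_id.
by apply: eq_map => l /=; rewrite letter_invK.
Qed.

Lemma free_groupP : is_group free_mul free_one free_inv.
Proof.
split.
- move=> [u ru] [v rv] [w rw]; apply: val_inj => /=.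
  elim: u ru => //= l u IHu ru; have {}ru := reduced_behead ru.
  by rewrite IHu // foldr_pushM // foldr_push_reduced.
- by move=> u; apply: val_inj.
- by move=> u; apply: val_inj; rewrite /= foldr_push_nil //; exact: valP.
- by move=> u; apply: val_inj; rewrite /= foldr_push_inv //; exact: valP.
- move=> u; apply: val_inj => /=.
  by have := foldr_push_inv (word_inv_reduced (valP u)); rewrite word_invK.
Qed.

Definition free_group : group := Group free_groupP.

Definition free_letter l : free_group := exist _ [:: l] isT.
Definition free_gen (c : T) : free_group := free_letter (c, false).

Definition letter_eval (G : group) (f : T -> G) l : G :=
  if l.2 then - f l.1 else f l.1.

Definition free_lift (G : group) (f : T -> G) (w : free_group) : G :=
  foldr (fun l g => letter_eval f l + g) 0 (val w).

Lemma free_pushE l (g : free_group) : free_push l g = free_letter l + g.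
Proof. exact: val_inj. Qed.

Lemma free_ind (P : free_group -> Prop) :
  P 0 -> (forall l g, P g -> P (free_letter l + g)) -> forall g, P g.
Proof.
move=> P0 Pl [w rw]; elim: w rw => [|l w IHw] rw.
  by have -> : exist _ [::] rw = 0 :> free_group by exact: val_inj.
have -> : exist _ (l :: w) rw
    = free_letter l + exist _ w (reduced_behead rw) :> free_group.
  by apply: val_inj; rewrite /= pushE.
exact: Pl.
Qed.

Lemma free_letterN l : - free_letter l = free_letter (letter_inv l).
Proof. exact: val_inj. Qed.

Lemma free_genN c : - free_gen c = free_letter (c, true).
Proof. exact: val_inj. Qed.

Lemma foldr_pushE (S : Type) (h : T * bool -> S -> S) (s : S) l w :
  (forall l s, h l (h (letter_inv l) s) = s) ->
  foldr h s (push l w) = h l (foldr h s w).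
Proof.
by move=> hK; case: w => // m w /=; case: ifPn => // /asboolP -> /=; rewrite hK.
Qed.

Section Lift.
Variables (G : group) (f : T -> G).

Lemma letter_evalN l : letter_eval f (letter_inv l) = - letter_eval f l.
Proof. by case: l => c []; rewrite /letter_eval /= ?gNN. Qed.

Lemma free_lift_letter l : free_lift f (free_letter l) = letter_eval f l.
Proof. by rewrite /free_lift /= g0r. Qed.

Lemma free_liftD (u v : free_group) :
  free_lift f (u + v) = free_lift f u + free_lift f v.
Proof.
rewrite /free_lift /=; elim: (val u) => [|l w IHw] /=; first by rewrite g0l.
rewrite foldr_pushE ?IHw ?gA // => m g.
by rewrite letter_evalN !gsimp.
Qed.

Lemma free_lift0 : free_lift f 0 = 0. Proof. by []. Qed.

Lemma free_liftN (u : free_group) : free_lift f (- u) = - free_lift f u.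
Proof. by apply/esym/gN_uniq; rewrite -free_liftD gNr. Qed.

End Lift.

End FreeGroup.

Definition free_map (T U : Type) (f : T -> U) : free_group T -> free_group U :=
  free_lift (fun c => free_gen (f c)).

(* [S] is a free basis of [G]: the homomorphism from the free group on the set
   [S] to [G] induced by the inclusion of [S] is bijective. *)
Definition is_free_basis (G : group) (S : set G) :=
  bijective (@free_lift {x : G | S x} G (fun s => sval s)).

(* [Gen x] is an element of X^(1) = X, and [Node f t] is x^(i+1)_{f,t}, where
   the index i is the level of the last letter of [f]. *)
Inductive symbol (X : Type) : Type :=
| Gen of X
| Node of seq (symbol X * bool) & symbol X.

Section Symbols.
Variable X : Type.
Implicit Types (s t : symbol X) (f : seq (symbol X * bool)).

Fixpoint level s : nat :=
  match s with
  | Gen _ => 1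
  | Node f _ => (last 0%N [seq level l.1 | l <- f]).+1
  end.

Definition last_level f : nat := last 0%N [seq level l.1 | l <- f].

(* [Node f t] is x^(i+1)_{f,t} with i = last_level f: the word [f] is reduced
   and non-empty, its letters are in A_i up to inversion, and [t] is in A_i. *)
Fixpoint wf_symbol s : bool :=
  match s with
  | Gen _ => true
  | Node f t =>
      [&& (0 < size f)%N, reduced f,
          all (fun l => wf_symbol l.1 && (level l.1 <= last_level f)) f,
          wf_symbol t & level t <= last_level f]
  end.

(* The set A_n; the set X^(i) consists of its elements of level i <= n. *)
Definition alphabet (n : nat) : Type :=
  {s : symbol X | wf_symbol s && (level s <= n)}.

Definition symbol_level n (c : alphabet n) : nat := level (val c).

Lemma alphabet_le m n : m <= n ->
  forall c : alphabet m, wf_symbol (val c) && (level (val c) <= n).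
Proof. by move=> mn [s /= /andP[-> /leq_trans->]]. Qed.

Definition alphabet_incl m n (mn : m <= n) (c : alphabet m) : alphabet n :=
  exist _ (val c) (alphabet_le mn c).

Lemma last_level_push m f : (0 < size f)%N -> f <> [:: letter_inv m] ->
  last_level (push m f) = last_level f.
Proof.
case: f => // l f _ /=; case: asboolP => [->|_ _] //.
by case: f => // k f _; rewrite /last_level /= !last_map.
Qed.

Lemma size_push m f : (0 < size f)%N -> f <> [:: letter_inv m] ->
  (0 < size (push m f))%N.
Proof.
by case: f => // l f _ /=; case: asboolP => [->|_ _] //; case: f.
Qed.

Lemma all_push (P : pred (symbol X * bool)) m f :
  P m -> all P f -> all P (push m f).
Proof.
case: f => [|l f] /= Pm; first by rewrite Pm.
by case: asboolP => _ /= /andP[Pl Pf]; rewrite ?Pm ?Pl ?Pf.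
Qed.

Lemma push_neq1 m f : reduced f -> (0 < size f)%N -> push m f <> [:: m].
Proof.
case: f => // l f rf _ /=; case: asboolP => [e|_ [//]] h.
by move: rf; rewrite h reduced_cons asboolT // e letter_invK.
Qed.

End Symbols.

Section Realisation.
Variables (X : Type) (n : nat).
Let A := alphabet X n.
Let F := free_group A.
Implicit Types (a b c : A) (l m : A * bool) (g h u v w : F).

Definition symbol_letter l : symbol X * bool := (val l.1, l.2).

(* The generator x_{f,t}. The symbol [Node f t] is in A_n wherever this is used
   below, so that the default value [b] of [insubd] does not matter. *)
Definition symbol_gen b (f : seq (symbol X * bool)) (t : symbol X) : F :=
  free_gen (insubd b (Node f t)).

(* The value lambda_l(b), for [l] in A_n or the inverse of an element of A_n.
   The last branch is not reached, because [b] has level at least 2 there. *)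
Definition lambda_gen l b : F :=
  if symbol_level l.1 == n then free_gen b
  else if symbol_level b <= symbol_level l.1 then
    symbol_gen b [:: symbol_letter l] (val b) + free_gen b
  else if val b is Node f t then
    if `[< f = [:: letter_inv (symbol_letter l)] >] then
      - symbol_gen b [:: symbol_letter l] t
    else symbol_gen b (push (symbol_letter l) f) t
  else free_gen b.

Definition lambda_letter l : F -> F := free_lift (lambda_gen l).

Definition lambda_word u : F -> F := fun g => foldr lambda_letter g (val u).

(* pi(inverse of c) is determined by 0 = pi(inverse of c) + lambda(pi(c)),
   where lambda is that of the inverse of c. *)
Definition cocycle_letter l : F :=
  if l.2 then - lambda_letter l (free_gen l.1) else free_gen l.1.

Definition cocycle u : F :=
  foldr (fun l g => cocycle_letter l + lambda_letter l g) 0 (val u).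

#[local] Arguments lambda_letter : simpl never.
#[local] Arguments lambda_word : simpl never.
#[local] Arguments cocycle : simpl never.

Notation lev := symbol_level.

Lemma lev_le c : lev c <= n.
Proof. by have /andP[] := valP c. Qed.

Lemma lev_neq c : (lev c == n) = false -> lev c < n.
Proof. by move=> h; rewrite ltn_neqAle h lev_le. Qed.

Lemma lev_gt0 c : (0 < lev c)%N.
Proof. by case: c => -[]. Qed.

Lemma symbol_genE b f t x : val x = Node f t -> symbol_gen b f t = free_gen x.
Proof.
move=> e; congr free_gen; apply: val_inj; rewrite val_insubd -e.
by rewrite (valP x).
Qed.

Lemma lambda_gen1 l b : lev l.1 = n -> lambda_gen l b = free_gen b.
Proof. by rewrite /lambda_gen => ->; rewrite eqxx. Qed.

Lemma lambda_gen2 l b x : lev l.1 < n -> lev b <= lev l.1 ->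
  val x = Node [:: symbol_letter l] (val b) ->
  lambda_gen l b = free_gen x + free_gen b.
Proof.
by rewrite /lambda_gen => h -> e; rewrite ltn_eqF // (symbol_genE _ e).
Qed.

Lemma lambda_gen3 l b x t : lev l.1 < lev b ->
  val b = Node [:: letter_inv (symbol_letter l)] t ->
  val x = Node [:: symbol_letter l] t ->
  lambda_gen l b = - free_gen x.
Proof.
rewrite /lambda_gen => h eb ex; rewrite ltn_eqF ?(leq_trans h (lev_le _)) //.
by rewrite leqNgt h /= eb asboolT // (symbol_genE _ ex).
Qed.

Lemma lambda_gen4 l b x f t : lev l.1 < lev b ->
  val b = Node f t -> f <> [:: letter_inv (symbol_letter l)] ->
  val x = Node (push (symbol_letter l) f) t ->
  lambda_gen l b = free_gen x.
Proof.
rewrite /lambda_gen => h eb nf ex; rewrite ltn_eqF ?(leq_trans h (lev_le _)) //.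
by rewrite leqNgt h /= eb asboolF // (symbol_genE _ ex).
Qed.

Let mkA s (h : wf_symbol s && (level s <= n)) : A := exist _ s h.

Lemma symbol2P l b : lev l.1 < n -> lev b <= lev l.1 ->
  {x : A | val x = Node [:: symbol_letter l] (val b)}.
Proof.
move=> ln bl.
suff h : wf_symbol (Node [:: symbol_letter l] (val b))
     && (level (Node [:: symbol_letter l] (val b)) <= n).
  by exists (mkA h).
move: (valP l.1) (valP b) => /andP[wl _] /andP[wb _] /=.
by rewrite wl wb /last_level /= leqnn bl.
Qed.

Lemma symbol3P l b : lev l.1 < lev b ->
  exists f t, [/\ val b = Node f t, reduced f, (0 < size f)%N,
    f = [:: letter_inv (symbol_letter l)] ->
      exists x : A, val x = Node [:: symbol_letter l] t /\ lev x = lev b &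
    f <> [:: letter_inv (symbol_letter l)] ->
      exists x : A, val x = Node (push (symbol_letter l) f) t /\ lev x = lev b].
Proof.
rewrite /lev; case: b => -[y|f t] /= hb.
  by move=> h; have := leq_trans (lev_gt0 l.1) h.
rewrite -/(last_level f) ltnS => lf.
have /andP[/and5P[sf rf wf wt tf] fn] := hb.
have /andP[wl _] := valP l.1.
exists f, t; split=> // hf.
  suff h : wf_symbol (Node [:: symbol_letter l] t)
       && (level (Node [:: symbol_letter l] t) <= n).
    by exists (mkA h); split=> //; rewrite hf.
  move: tf fn; rewrite /= hf /last_level /= -/(lev l.1) => tf ->.
  by rewrite wl wt leqnn tf.
have e := last_level_push sf hf.
suff h : wf_symbol (Node (push (symbol_letter l) f) t)
     && (level (Node (push (symbol_letter l) f) t) <= n).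
  by exists (mkA h); split=> //=; rewrite -!/(last_level _) e.
rewrite /= -!/(last_level _) !e fn tf wt size_push // push_reduced //= andbT.
by rewrite all_push //= wl.
Qed.

Lemma symbol_letterN l :
  symbol_letter (letter_inv l) = letter_inv (symbol_letter l).
Proof. by []. Qed.

Lemma lambda_letterD l g h :
  lambda_letter l (g + h) = lambda_letter l g + lambda_letter l h.
Proof. exact: free_liftD. Qed.

Lemma lambda_letter0 l : lambda_letter l 0 = 0. Proof. by []. Qed.

Lemma lambda_letterN l g : lambda_letter l (- g) = - lambda_letter l g.
Proof. exact: free_liftN. Qed.

Lemma lambda_letter_gen l b : lambda_letter l (free_gen b) = lambda_gen l b.
Proof. exact: free_lift_letter. Qed.

Lemma lambda_letterVK_gen l b :
  lambda_letter (letter_inv l) (lambda_gen l b) = free_gen b.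
Proof.
case: (eqVneq (lev l.1) n) => [ln|/negbTE/lev_neq ln].
  by rewrite lambda_gen1 // lambda_letter_gen lambda_gen1.
have [bl|lb] := leqP (lev b) (lev l.1).
  have [x ex] := symbol2P ln bl.
  have [y ey] := @symbol2P (letter_inv l) b ln bl.
  have lx : lev l.1 < lev x by rewrite /lev ex.
  rewrite (lambda_gen2 ln bl ex) lambda_letterD !lambda_letter_gen.
  rewrite (@lambda_gen2 (letter_inv l) b y) //.
  rewrite (@lambda_gen3 (letter_inv l) x y (val b)) //.
    by rewrite gA gNl g0l.
  by rewrite symbol_letterN letter_invK.
have [f [t [eb rf sf h1 h2]]] := symbol3P lb.
have [ef|nf] := pselect (f = [:: letter_inv (symbol_letter l)]).
  have [x [ex lx]] := h1 ef; subst f.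
  rewrite (lambda_gen3 lb eb ex) lambda_letterN lambda_letter_gen.
  rewrite (@lambda_gen3 (letter_inv l) x b t) ?lx ?gNN //.
  by rewrite symbol_letterN letter_invK.
have [x [ex lx]] := h2 nf.
rewrite (lambda_gen4 lb eb nf ex) lambda_letter_gen.
apply: (@lambda_gen4 (letter_inv l) x b _ t _ ex); first by rewrite lx.
  by rewrite symbol_letterN letter_invK; exact: push_neq1.
by rewrite symbol_letterN pushK.
Qed.

Lemma free_ext (f1 f2 : F -> F) :
  (forall g h, f1 (g + h) = f1 g + f1 h) ->
  (forall g h, f2 (g + h) = f2 g + f2 h) ->
  (forall c, f1 (free_gen c) = f2 (free_gen c)) -> forall g, f1 g = f2 g.
Proof.
move=> D1 D2 e.
have z (f : F -> F) : (forall g h, f (g + h) = f g + f h) -> f 0 = 0.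
  by move=> D; apply: (@gIl _ _ _ (f 0)); rewrite -D g0l g0r.
have N (f : F -> F) (D : forall g h, f (g + h) = f g + f h) g : f (- g) = - f g.
  by apply/esym/gN_uniq; rewrite -D gNr z.
apply: free_ind => [|[c s] g eg]; first by rewrite !z.
rewrite D1 D2 eg; congr (_ + _); case: s; last exact: e.
by rewrite -free_genN !N // e.
Qed.

Lemma lambda_letterVK l g : lambda_letter (letter_inv l) (lambda_letter l g) = g.
Proof.
move: g; apply: (free_ext (f2 := id)) => [g h|//|c].
  by rewrite !lambda_letterD.
by rewrite lambda_letter_gen lambda_letterVK_gen.
Qed.

Lemma lambda_letterK l g : lambda_letter l (lambda_letter (letter_inv l) g) = g.
Proof. by rewrite -{1}(letter_invK l) lambda_letterVK. Qed.

Lemma lambda_wordD u g h : lambda_word u (g + h) = lambda_word u g + lambda_word u h.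
Proof.
rewrite /lambda_word; elim: (val u) => //= l w ->; exact: lambda_letterD.
Qed.

Lemma lambda_word_r0 u : lambda_word u 0 = 0.
Proof. by apply: (@gIl _ _ _ (lambda_word u 0)); rewrite -lambda_wordD g0l g0r. Qed.

Lemma lambda_wordN u g : lambda_word u (- g) = - lambda_word u g.
Proof. by apply/esym/gN_uniq; rewrite -lambda_wordD gNr lambda_word_r0. Qed.

Lemma lambda_wordM u v g : lambda_word (u + v) g = lambda_word u (lambda_word v g).
Proof.
rewrite /lambda_word /=; elim: (val u) => //= l w IHw.
by rewrite foldr_pushE ?IHw // => m h; exact: lambda_letterK.
Qed.

Lemma lambda_word0 g : lambda_word 0 g = g. Proof. by []. Qed.

Lemma lambda_word_letter l g : lambda_word (free_letter l) g = lambda_letter l g.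
Proof. by []. Qed.

Lemma lambda_wordK u g : lambda_word u (lambda_word (- u) g) = g.
Proof. by rewrite -lambda_wordM gNr. Qed.

Lemma lambda_wordVK u g : lambda_word (- u) (lambda_word u g) = g.
Proof. by rewrite -lambda_wordM gNl. Qed.

Lemma cocycle_letterV l :
  cocycle_letter l + lambda_letter l (cocycle_letter (letter_inv l)) = 0.
Proof.
case: l => c [].
  by have := gNl (lambda_letter (c, true) (free_gen c)).
have := lambda_letterK (c, false) (free_gen c).
rewrite -[X in X = _]gNN -lambda_letterN => h.
by rewrite -[X in X + _]h; exact: gNl.
Qed.

Lemma cocycle_cons l u :
  cocycle (free_letter l + u) = cocycle_letter l + lambda_letter l (cocycle u).
Proof.
rewrite /cocycle -free_pushE foldr_pushE // => m g.
by rewrite lambda_letterD lambda_letterK gA cocycle_letterV g0l.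
Qed.

Lemma cocycle0 : cocycle 0 = 0. Proof. by []. Qed.

Lemma cocycleM u v : cocycle (u + v) = cocycle u + lambda_word u (cocycle v).
Proof.
move: u; apply: free_ind => [|l u IHu]; first by rewrite cocycle0 !g0l.
by rewrite -gA !cocycle_cons IHu lambda_letterD gA lambda_wordM.
Qed.

Lemma cocycle_letterE l : cocycle (free_letter l) = cocycle_letter l.
Proof. exact: g0r. Qed.

Lemma cocycle_gen c : cocycle (free_gen c) = free_gen c.
Proof. exact: cocycle_letterE. Qed.

Definition high i g : bool := all (fun l => i <= lev l.1) (val g).

Lemma high_push i l s : i <= lev l.1 -> all (fun l => i <= lev l.1) s ->
  all (fun l : A * bool => i <= lev l.1) (push l s).
Proof.
move=> il; case: s => [|m s] /=; first by rewrite il.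
by case: asboolP => _ /= /andP[im is_]; rewrite ?il ?im ?is_.
Qed.

Lemma highD i g h : high i g -> high i h -> high i (g + h).
Proof.
rewrite /high /= => hg hh; elim: (val g) hg => //= l s IHs /andP[il /IHs].
exact: high_push.
Qed.

Lemma highN i g : high i g -> high i (- g).
Proof. by rewrite /high /= /word_inv all_rev all_map. Qed.

Lemma high0 i : high i 0. Proof. by []. Qed.

Lemma high_letter i l : high i (free_letter l) = (i <= lev l.1).
Proof. by rewrite /high /= andbT. Qed.

Lemma high_gen i c : high i (free_gen c) = (i <= lev c).
Proof. exact: high_letter. Qed.

Lemma high_genN i c : high i (- free_gen c) = (i <= lev c).
Proof. exact: high_letter. Qed.

Lemma high_le i j g : i <= j -> high j g -> high i g.
Proof. by move=> ij; apply: sub_all => l; exact: leq_trans. Qed.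

Lemma high_top i g : n < i -> high i g -> g = 0.
Proof.
move=> ni; case: g => -[|l s] r; rewrite /high /=; first by move=> _; exact: val_inj.
by move/andP=> [/(leq_trans ni)]; rewrite ltnNge lev_le.
Qed.

Lemma high1 g : high 1 g.
Proof. by rewrite /high; elim: (val g) => //= l s ->; rewrite lev_gt0. Qed.

Lemma high_ind i (P : F -> Prop) :
  P 0 ->
  (forall g l, high i g -> i <= lev l.1 -> P g -> P (g + free_letter l)) ->
  forall g, high i g -> P g.
Proof.
move=> P0 Pl g.
pose prod := foldr (fun l (h : F) => free_letter l + h) 0.
have prodE : prod (val g) = g.
  move: g; apply: free_ind => // l g IHg.
  rewrite -free_pushE /prod foldr_pushE -/prod; first by rewrite IHg free_pushE.
  by move=> m h; rewrite gA -free_letterN gNr g0l.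
have prod_rcons s l : prod (rcons s l) = prod s + free_letter l.
  elim: s => [|m s IHs]; first exact: etrans (g0r _) (esym (g0l _)).
  rewrite rcons_cons -[LHS]/(free_letter m + prod (rcons s l)) IHs.
  exact: (gA (free_letter m)).
have high_prod s : all (fun l => i <= lev l.1) s -> high i (prod s).
  elim: s => //= l s IHs /andP[il /IHs hs].
  by apply: (highD _ hs); rewrite high_letter.
rewrite /high -{2}prodE; elim/last_ind: (val g) => //= s l IHs.
rewrite all_rcons prod_rcons => /andP[il hs].
by apply: Pl => //; [exact: high_prod | exact: IHs].
Qed.

Lemma high_lambda_gen i l b : i <= lev b -> high i (lambda_gen l b).
Proof.
move=> ib; case: (eqVneq (lev l.1) n) => [ln|/negbTE/lev_neq ln].
  by rewrite lambda_gen1 // high_gen.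
have [bl|lb] := leqP (lev b) (lev l.1).
  have [x ex] := symbol2P ln bl; rewrite (lambda_gen2 ln bl ex).
  apply: highD; rewrite high_gen // /lev ex /=.
  exact: leq_trans (leq_trans ib bl) (leqnSn _).
have [f [t [eb rf sf h1 h2]]] := symbol3P lb.
have [ef|nf] := pselect (f = [:: letter_inv (symbol_letter l)]).
  have [x [ex lx]] := h1 ef; subst f.
  by rewrite (lambda_gen3 lb eb ex) high_genN lx.
by have [x [ex lx]] := h2 nf; rewrite (lambda_gen4 lb eb nf ex) high_gen lx.
Qed.

Lemma high_lambda_letter i l g : high i g -> high i (lambda_letter l g).
Proof.
apply: (@high_ind i (fun g => high i (lambda_letter l g))) => // h [c s] _ /= ic hh.
rewrite lambda_letterD; apply: highD => //.
case: s; last by rewrite lambda_letter_gen; exact: high_lambda_gen.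
rewrite -free_genN lambda_letterN lambda_letter_gen.
exact/highN/high_lambda_gen.
Qed.

Lemma high_lambda i u g : high i g -> high i (lambda_word u g).
Proof.
rewrite /lambda_word; elim: (val u) => //= l w IHw hg.
exact/high_lambda_letter/IHw.
Qed.

Lemma high_lambda_low i u c : high i u -> lev c <= i ->
  high i.+1 (lambda_word u (free_gen c) - free_gen c).
Proof.
move=> + ci; move: u; apply: high_ind => [|u l _ il hu].
  by rewrite lambda_word0 gNr.
rewrite lambda_wordM lambda_word_letter lambda_letter_gen.
rewrite -[lambda_gen l c](gNK _ (free_gen c)) lambda_wordD -gA.
apply: highD => //; apply: high_lambda.
case: (eqVneq (lev l.1) n) => [ln|/negbTE/lev_neq ln].
  by rewrite lambda_gen1 // gNr.
have cl := leq_trans ci il.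
have [x ex] := symbol2P ln cl; rewrite (lambda_gen2 ln cl ex) gK.
by rewrite high_gen /lev ex.
Qed.

Lemma level_ind (P : nat -> Prop) :
  (forall i, n < i -> P i) ->
  (forall i, (forall j, i < j -> P j) -> P i) -> forall i, P i.
Proof.
move=> Ptop Pstep i.
have [k] := ubnP (n.+1 - i); elim: k i => // k IHk i; rewrite ltnS => ik.
have [ni|ni] := ltnP n i; first exact: Ptop.
apply: Pstep => j ij; have [nj|nj] := ltnP n j; first exact: Ptop.
by apply/IHk/(leq_trans _ ik)/ltn_sub2l.
Qed.

Lemma cocycleV c :
  cocycle (- free_gen c) = - lambda_word (- free_gen c) (free_gen c).
Proof. by rewrite free_genN cocycle_letterE /cocycle_letter. Qed.

Lemma cocycle_surj_high i g : high i g -> exists2 u, high i u & cocycle u = g.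
Proof.
move: i g; apply: level_ind => [i ni|i IHi] g.
  by move=> hg; exists 0; rewrite ?cocycle0 // (high_top ni hg).
have R c j s : lev c = i -> i < j -> high j s ->
    exists2 u, high i u & cocycle u = s + free_gen c.
  move=> ci; move: j s; apply: level_ind => [j nj|j IHj] s ij hs.
    exists (free_gen c); first by rewrite high_gen ci.
    by rewrite cocycle_gen (high_top nj hs) g0l.
  have [u hu eu] := IHi j ij s hs.
  have hp : high j.+1 (lambda_word (- u) (free_gen c) - free_gen c).
    by apply: high_lambda_low; rewrite ?ci ?(ltnW ij) //; exact: highN.
  have [v hv ev] := IHj j.+1 (ltnSn j) _ (ltnW ij) hp.
  exists (u + v); first by apply: highD => //; exact: high_le (ltnW ij) hu.
  by rewrite cocycleM ev gNK lambda_wordK eu.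
have C u h : high i u -> (exists2 v, high i v & cocycle v = lambda_word (- u) h) ->
    exists2 w, high i w & cocycle w = cocycle u + h.
  move=> hu [v hv ev]; exists (u + v); first exact: highD.
  by rewrite cocycleM ev lambda_wordK.
apply: (@high_ind i (fun g => exists2 u, high i u & cocycle u = g)).
  by exists 0.
move=> {}g [c s] _ ic [u hu <-]; rewrite /= in ic; apply: C => //.
have [ci|ci] := eqVneq i (lev c); last first.
  have {}ic : i < lev c by rewrite ltn_neqAle ci.
  have [|v hv ev] := IHi i.+1 (ltnSn i) (lambda_word (- u) (free_letter (c, s))).
    by apply: high_lambda; rewrite high_letter.
  by exists v => //; exact: high_le (leqnSn _) hv.
have hp : high i.+1 (lambda_word (- u) (free_gen c) - free_gen c).
  by apply: high_lambda_low; rewrite ?ci // -?ci //; exact: highN.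
have e : lambda_word (- u) (free_gen c)
    = (lambda_word (- u) (free_gen c) - free_gen c) + free_gen c by rewrite gNK.
case: s; last first.
  rewrite -/(free_gen c) e; exact: R hp.
rewrite -free_genN lambda_wordN e; set p := _ - free_gen c in hp *.
pose q := lambda_word (- free_gen c) (free_gen c) - free_gen c.
have hq : high i.+1 q by apply: high_lambda_low; rewrite ?high_genN ?ci.
have eq : cocycle (- free_gen c) = - free_gen c - q.
  by rewrite cocycleV -gND gNK.
have [|v hv ev] := IHi i.+1 (ltnSn i) (lambda_word (free_gen c) (q - p)).
  by apply: high_lambda; apply: highD => //; exact: highN.
exists (- free_gen c + v).
  by apply: highD; rewrite ?high_genN -?ci //; exact: high_le (leqnSn _) hv.
by rewrite cocycleM ev lambda_wordVK eq !gsimp.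
Qed.

Lemma cocycle_ker_inj i :
  (forall u, high i u -> cocycle u = 0 -> u = 0) ->
  forall u v, high i u -> high i v -> cocycle u = cocycle v -> u = v.
Proof.
move=> K u v hu hv e; apply: (@gIl _ _ _ (- v)); rewrite gNl.
apply: K; first by apply: highD => //; exact: highN.
by rewrite cocycleM e -cocycleM gNl.
Qed.

Definition drift u c : F := lambda_word u (free_gen c) - free_gen c.

Lemma driftE u c : lambda_word u (free_gen c) = drift u c + free_gen c.
Proof. by rewrite /drift gNK. Qed.

Lemma high_drift i u c : high i u -> lev c <= i -> high i.+1 (drift u c).
Proof. exact: high_lambda_low. Qed.

Lemma driftM u v c : drift (u + v) c = lambda_word u (drift v c) + drift u c.
Proof. by rewrite /drift lambda_wordM -/(drift u c) driftE lambda_wordD /drift !gsimp. Qed.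

Lemma drift_ker i c : lev c = i ->
  (forall u, high i.+1 u -> cocycle u = 0 -> u = 0) ->
  forall u, high i.+1 u -> cocycle u + drift u c = 0 -> u = 0.
Proof.
move=> ci K u hu e.
suff hj : forall k, high (i.+1 + k)%N u.
  by apply: (high_top _ (hj n)); rewrite addSn ltnS leq_addl.
elim=> [|k IHk]; first by rewrite addn0.
have hd : high (i.+1 + k).+1 (drift u c).
  by apply: high_drift => //; rewrite ci addSn ltnW // ltnS leq_addr.
have [v hv ev] := cocycle_surj_high (highN hd).
rewrite addnS; suff -> : u = v by [].
apply: (cocycle_ker_inj K) => //.
  by apply: (high_le _ hv); rewrite ltnS leqW // leq_addr.
by rewrite ev; apply: (@gIr _ _ _ (drift u c)); rewrite e gNl.
Qed.

Definition ends_with l g := exists s, val g = rcons s l.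

Lemma val_letter_r g l : reduced (rcons (val g) l) ->
  val (g + free_letter l) = rcons (val g) l.
Proof.
rewrite /=; elim: (val g) => //= m s IHs r.
rewrite IHs; last by apply: reduced_behead r.
by rewrite pushE.
Qed.

Lemma val_cat g h : reduced (val g ++ val h) -> val (g + h) = val g ++ val h.
Proof.
rewrite /=; elim: (val g) => //= m s IHs r.
by rewrite IHs ?pushE //; exact: reduced_behead r.
Qed.

Lemma reduced_high_rcons i h l : lev l.1 = i -> high i.+1 h ->
  reduced (rcons (val h) l).
Proof.
case: h => s r li; rewrite /high /= => hs.
elim/last_ind: s r hs => // s m _ r; rewrite all_rcons => /andP[hm _].
rewrite -!cats1 -catA /= reduced_cat r /= andbT.
apply/asboolP => e; move: hm; rewrite -[m](letter_invK) -e.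
by rewrite /= li ltnn.
Qed.

Lemma reduced_high_cons i h l : lev l.1 = i -> high i.+1 h ->
  reduced (l :: val h).
Proof.
case: h => s r li; rewrite /high [val _]/=; case: s r => // m s r /andP[hm _].
rewrite reduced_cons r andbT; apply/asboolP => e; move: hm.
by rewrite e /= li ltnn.
Qed.

Lemma reduced_sandwich i g h l m :
  lev l.1 = i -> lev m.1 = i -> ends_with l g -> high i.+1 h ->
  (h = 0 -> m <> letter_inv l) -> ends_with m (g + h + free_letter m).
Proof.
move=> li mi [s es] hh nm.
have rgh : reduced (val g ++ val h).
  rewrite es cat_rcons reduced_cat -es (valP g).
  exact: reduced_high_cons hh.
exists (val (g + h)); apply: val_letter_r; rewrite val_cat //.
have [h0|h0] := pselect (val h = [::]).
  rewrite h0 cats0 es -cats1 -cats1 -catA /= reduced_cat -es (valP g) /=.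
  by rewrite andbT; apply/asboolP; apply: nm; exact: val_inj.
have rm := reduced_high_rcons mi hh.
rewrite rcons_cat; case: (val h) h0 rgh rm => // k t _.
by rewrite rcons_cons !reduced_cat => /andP[-> _] /=.
Qed.

Lemma ends_with_high_neq0 i g h l :
  lev l.1 = i -> ends_with l g -> high i.+1 h -> g + h <> 0.
Proof.
move=> li [s es] hh e.
have : val (g + h) = val g ++ val h.
  apply: val_cat; rewrite es cat_rcons reduced_cat -es (valP g).
  exact: reduced_high_cons hh.
by rewrite e es cat_rcons /=; case: s {es}.
Qed.

Lemma high_cocycle i u : high i u -> high i (cocycle u).
Proof.
apply: (@high_ind i (fun u => high i (cocycle u))) => // w k hw ik hcw.
rewrite cocycleM; apply: highD => //.
apply: high_lambda; rewrite cocycle_letterE /cocycle_letter.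
case: k ik => c [] /= ik; last by rewrite high_gen.
by apply/highN/high_lambda_letter; rewrite high_gen.
Qed.

(* If the word [u] ends with a letter [l] of its lowest level, then the reduced
   form of [cocycle u + tail_drift u l] ends with [l] as well. *)
Definition tail_drift u l : F := if l.2 then drift u l.1 else 0.

Definition good_end u l := ends_with l (cocycle u + tail_drift u l).

Lemma good_end_step i u v l m :
  (forall w, high i.+1 w -> cocycle w = 0 -> w = 0) ->
  lev l.1 = i -> lev m.1 = i -> high i u -> high i.+1 v -> good_end u l ->
  (v = 0 -> m <> letter_inv l) ->
  good_end (u + v + free_letter m) m.
Proof.
move=> K li mi hu hv gu nm.
have hi1 : forall c, lev c = i -> high i.+1 (drift u c).
  by move=> c ci; apply: high_drift => //; rewrite ci.
have ht : high i.+1 (tail_drift u l).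
  by rewrite /tail_drift; case: (l.2) => //; exact: hi1.
have hpv : high i.+1 (lambda_word u (cocycle v)).
  exact/high_lambda/high_cocycle.
case: m mi nm => d [] di nm; rewrite /= in di.
- set w := u + v + _; rewrite -[good_end _ _]/(ends_with _ (cocycle w + drift w d)).
  have -> : cocycle w + drift w d =
      cocycle u + tail_drift u l + (- tail_drift u l + lambda_word u (cocycle v))
      + free_letter (d, true).
    rewrite /w -free_genN cocycleM cocycleV lambda_wordN -lambda_wordM -/w driftE.
    by rewrite cocycleM !gsimp.
  apply: (@reduced_sandwich i _ _ l (d, true) li di gu); first by apply: highD => //; exact: highN.
  move=> e0 em; apply: (nm _ em); case: l em {nm} li gu ht e0 => c [] // [<-] li gu ht.
  rewrite -[tail_drift _ _]/(0 : F) gN0 g0l => e0.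
  apply: K => //.
  by rewrite -(lambda_wordVK u (cocycle v)) e0 lambda_word_r0.
- rewrite -[good_end _ _]/(ends_with _ (cocycle (u + v + free_gen d) + 0)).
  rewrite g0r cocycleM cocycle_gen driftE cocycleM driftM.
  have -> : cocycle u + lambda_word u (cocycle v) +
      (lambda_word u (drift v d) + drift u d + free_gen d) =
      cocycle u + tail_drift u l +
        (- tail_drift u l + lambda_word u (cocycle v + drift v d) + drift u d)
      + free_gen d.
    by rewrite lambda_wordD !gsimp.
  apply: (@reduced_sandwich i _ _ l (d, false) li di gu).
    apply: highD; last exact: hi1.
    apply: highD; first exact: highN.
    rewrite lambda_wordD; apply: highD => //; apply: high_lambda.
    by apply: (high_le _ (high_drift hv _)); rewrite // di.
  move=> e0 em; apply: (nm _ em); case: l em {nm} li gu ht e0 => c [] // [<-] li gu ht.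
  rewrite -[tail_drift _ _]/(drift u d) => e0.
  apply: (drift_ker di K hv).
  rewrite -[LHS](lambda_wordVK u); set z := lambda_word u _ in e0 *.
  suff -> : z = 0 by rewrite lambda_word_r0.
  have := congr1 (fun t => drift u d + t - drift u d) e0.
  by rewrite !gsimp.
Qed.

Lemma good_end_start i v m :
  lev m.1 = i -> high i.+1 v -> high i.+1 (cocycle v) ->
  good_end (v + free_letter m) m.
Proof.
case: m => d [] di hv hcv; rewrite /= in di.
- set w := v + _; rewrite -[good_end _ _]/(ends_with _ (cocycle w + drift w d)).
  have -> : cocycle w + drift w d = cocycle v + free_letter (d, true).
    rewrite /w -free_genN cocycleM cocycleV lambda_wordN -lambda_wordM -/w driftE.
    by rewrite !gsimp.
  exists (val (cocycle v)); apply: val_letter_r.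
  exact: reduced_high_rcons hcv.
- rewrite -[good_end _ _]/(ends_with _ (cocycle (v + free_gen d) + 0)).
  rewrite g0r cocycleM cocycle_gen driftE gA.
  have h : high i.+1 (cocycle v + drift v d).
    apply: highD => //.
    by apply: (high_le _ (high_drift hv _)); rewrite // di.
  by exists (val (cocycle v + drift v d)); apply: val_letter_r; exact: reduced_high_rcons h.
Qed.

Lemma cocycle_ker_high i u : high i u -> cocycle u = 0 -> u = 0.
Proof.
move: i u; apply: level_ind => [i ni|i IHi] u hu; first by rewrite (high_top ni hu).
have {IHi} K := IHi _ (ltnSn i).
(* words [x + v + r] with [x] ending with the letter [l] of level [i] *)
have E : forall (r : seq (A * bool)) x v l,
    lev l.1 = i -> high i x -> high i.+1 v -> good_end x l ->
    all (fun k => i <= lev k.1) r -> reduced (l :: val v ++ r) ->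
    forall w : F, val w = r -> cocycle (x + v + w) <> 0.
  elim=> [|k r IHr] x v l li hx hv gx hr red w ew.
    have -> : w = 0 :> F by exact: val_inj.
    rewrite g0r cocycleM -[cocycle x](gK _ (tail_drift x l)) -gA.
    apply: (ends_with_high_neq0 li gx); apply: highD.
      apply: highN; rewrite /tail_drift; case: (l.2) => //.
      by apply: high_drift => //; rewrite li.
    exact/high_lambda/high_cocycle.
  have /andP[ik {}hr] : (i <= lev k.1) && all (fun k => i <= lev k.1) r := hr.
  have rkr : reduced (k :: r) by rewrite -ew; exact: (valP w).
  pose w' : F := exist _ r (reduced_behead rkr).
  have -> : w = free_letter k + w' :> F.
    by apply: val_inj; rewrite ew /= pushE.
  rewrite gA; have rvk : reduced (val v ++ k :: r) by exact: reduced_behead red.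
  have rv : reduced (rcons (val v) k) by move: rvk; rewrite reduced_cat => /andP[].
  have [ki|ki] := eqVneq i (lev k.1).
    rewrite -[x + v + _]g0r; apply: (IHr _ 0 k) => //.
    - by apply: highD; rewrite ?high_letter //; apply: highD => //; exact: high_le (leqnSn _) hv.
    - apply: (good_end_step K li) => // v0; move: red; rewrite v0 => red.
      by have /andP[/asboolP] : ~~ `[< k = letter_inv l >] && reduced (k :: r) := red.
  rewrite -(gA x); apply: (IHr _ _ l) => //.
    by apply: highD; rewrite ?high_letter // ltn_neqAle ki.
  by rewrite val_letter_r // cat_rcons.
have S : forall (r : seq (A * bool)) v,
    high i.+1 v -> all (fun k => i <= lev k.1) r -> reduced (val v ++ r) ->
    forall w : F, val w = r -> cocycle (v + w) = 0 -> v + w = 0.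
  elim=> [|k r IHr] v hv hr red w ew.
    have -> : w = 0 :> F by exact: val_inj.
    by rewrite g0r; exact: K.
  have /andP[ik {}hr] : (i <= lev k.1) && all (fun k => i <= lev k.1) r := hr.
  have rkr : reduced (k :: r) by rewrite -ew; exact: (valP w).
  pose w' : F := exist _ r (reduced_behead rkr).
  have -> : w = free_letter k + w' :> F.
    by apply: val_inj; rewrite ew /= pushE.
  rewrite gA.
  have rv : reduced (rcons (val v) k) by move: red; rewrite reduced_cat => /andP[].
  have [ki|ki] := eqVneq i (lev k.1).
    rewrite -[v + _]g0r => e; case: (@E r (v + free_letter k) 0 k _ _ _ _ _ _ w') => //.
    - by apply: highD; rewrite ?high_letter //; exact: high_le (leqnSn _) hv.
    - by apply: (@good_end_start i) => //; exact: high_cocycle.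
  apply: IHr => //.
    by apply: highD; rewrite ?high_letter // ltn_neqAle ki.
  by rewrite val_letter_r // cat_rcons.
by have := S (val u) 0 (high0 _) hu (valP u) u erefl; rewrite !g0l.
Qed.

Lemma cocycle_inj : injective cocycle.
Proof.
move=> u v; apply: (cocycle_ker_inj (i := 1)); try exact: high1.
by move=> w; exact: cocycle_ker_high.
Qed.

Lemma cocycle_surj g : exists u, cocycle u = g.
Proof. by have [u _ eu] := cocycle_surj_high (high1 g); exists u. Qed.

Definition cocycle_inv g : F := sval (cid (cocycle_surj g)).

Lemma cocycle_invK g : cocycle (cocycle_inv g) = g.
Proof. exact: svalP (cid (cocycle_surj g)). Qed.

Lemma cocycleK u : cocycle_inv (cocycle u) = u.
Proof. by apply: cocycle_inj; rewrite cocycle_invK. Qed.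

(* The additive group is F_+(A_n); [cocycle_inv g + cocycle_inv h] is a product
   in F_o(A_n), which is the same group of reduced words. *)
Definition free_circ g h : F := cocycle (cocycle_inv g + cocycle_inv h).

Definition free_cinv g : F := cocycle (- cocycle_inv g).

Lemma free_circP : is_group free_circ 0 free_cinv.
Proof.
have e0 : cocycle_inv 0 = 0 by rewrite -[X in cocycle_inv X]cocycle0 cocycleK.
split=> [g h k|g|g|g|g]; rewrite /free_circ /free_cinv ?cocycleK ?e0.
- by rewrite gA.
- by rewrite g0l cocycle_invK.
- by rewrite g0r cocycle_invK.
- by rewrite gNl.
- by rewrite gNr.
Qed.

Lemma free_circDr g h k :
  free_circ g (h + k) = free_circ g h - g + free_circ g k.
Proof.
by rewrite /free_circ !cocycleM !cocycle_invK lambda_wordD !gsimp.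
Qed.

Definition free_right_nilpotent : skew_brace :=
  SkewBrace free_circP free_circDr.

End Realisation.

(* Main.v *)
(* Sending the symbol x_{f,t} with f = a_1 ∘ ... ∘ a_k to
   lambda_{a_1 ∘ ... ∘ a_(k-1)}(a_k * t) extends any map X -> C into a right
   nilpotent skew brace to a homomorphism on B, and a symbol of level k goes to
   C^(k). For C the realisation B' of class n - 1, which is right nilpotent by
   induction, this homomorphism B -> B' is the retraction
   r : F_+(A_n) -> F_+(A_(n-1)) killing X^(n), so that B^(n) lies in ker r;
   conversely, ker r is generated by the conjugates of X^(n), which lies in
   B^(n). As r commutes with the cocycles and that of B' is injective, an element
   of ker r corresponds to a product of conjugates of letters of level n in
   F_o(A_n), hence acts trivially through lambda; this gives both B^(n+1) = 0
   and the triviality of B^(n). Finally, F(U + V) is the semidirect product of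
   the free group on F(U) x V and F(U), acting by left translation on the first
   factor, so the kernel of F(U + V) -> F(U) is free on the conjugates of V by
   F(U). *)
Require Import Defs.
From mathcomp Require Import all_boot.
From mathcomp Require Import boolp classical_sets.
Local Open Scope classical_set_scope.
Local Open Scope brace_scope.

Set Implicit Arguments.
Unset Strict Implicit.
Unset Printing Implicit Defensive.

#[local] Arguments gadd : simpl never.
#[local] Arguments gopp : simpl never.
#[local] Arguments gzero : simpl never.

(** * Additive maps and homomorphisms out of free groups *)

Section AdditiveMaps.
Variables (G H : group) (f : G -> H).
Hypothesis fD : forall x y, f (x + y) = f x + f y.

Lemma additive0 : f 0 = 0.
Proof. by apply: (@gIl _ _ _ (f 0)); rewrite -fD !g0r. Qed.

Lemma additiveN x : f (- x) = - f x.
Proof. by apply/esym/gN_uniq; rewrite -fD gNr additive0. Qed.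

End AdditiveMaps.

Lemma free_hom_ext (T : Type) (G : group) (f1 f2 : free_group T -> G) :
  (forall g h, f1 (g + h) = f1 g + f1 h) ->
  (forall g h, f2 (g + h) = f2 g + f2 h) ->
  (forall c, f1 (free_gen c) = f2 (free_gen c)) -> forall g, f1 g = f2 g.
Proof.
move=> D1 D2 e; apply: free_ind => [|[c s] g eg]; first by rewrite !additive0.
rewrite D1 D2 eg; congr (_ + _); case: s; last exact: e.
by rewrite -free_genN !additiveN // e.
Qed.

Lemma free_lift_gen (T : Type) (G : group) (f : T -> G) c :
  free_lift f (free_gen c) = f c.
Proof. by rewrite free_lift_letter. Qed.

Lemma free_mapD (T U : Type) (f : T -> U) g h :
  free_map f (g + h) = free_map f g + free_map f h.
Proof. exact: free_liftD. Qed.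

Lemma free_map_gen (T U : Type) (f : T -> U) c :
  free_map f (free_gen c) = free_gen (f c).
Proof. exact: free_lift_gen. Qed.

Lemma free_map_id (T : Type) (f : T -> T) : f =1 id -> free_map f =1 id.
Proof.
move=> fid; apply: free_hom_ext => // [g h|c]; first exact: free_mapD.
by rewrite free_map_gen fid.
Qed.

Lemma free_map_comp (T U V : Type) (f : U -> V) (g : T -> U) w :
  free_map f (free_map g w) = free_map (f \o g) w.
Proof.
by move: w; apply: free_hom_ext => [x y|x y|c]; rewrite ?(free_mapD, free_map_gen).
Qed.

Lemma free_lift_map (T U : Type) (G : group) (f : U -> G) (g : T -> U) w :
  free_lift f (free_map g w) = free_lift (f \o g) w.
Proof.
move: w; apply: free_hom_ext => [x y|x y|c].
- by rewrite free_mapD free_liftD.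
- exact: free_liftD.
- by rewrite free_map_gen !free_lift_gen.
Qed.

(** * The kernel of the retraction F(U + V) -> F(U) *)

Section RetractionKernel.
Variables (T U V : Type) (e : U + V -> T) (d : T -> (U + V)%type).
Hypotheses (eK : cancel e d) (dK : cancel d e).

(** The alphabet A_n is not literally a sum type, so [T] is only in bijection with [U + V], through
    [e] and [d]. *)
Definition incl : free_group U -> free_group T := free_map (fun u => e (inl u)).

Definition retract : free_group T -> free_group U :=
  free_lift (fun c => if d c is inl u then free_gen u else 0).

Let P := free_group (free_group U * V).
Implicit Types (p q : P) (a b : free_group U).

Definition conj_gen (s : free_group U * V) : free_group T :=
  incl s.1 + free_gen (e (inr s.2)) - incl s.1.

Definition conj_lift : P -> free_group T := free_lift conj_gen.

Definition shift a : P -> P := free_map (fun s => (a + s.1, s.2)).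

Lemma inclD a b : incl (a + b) = incl a + incl b.
Proof. exact: free_mapD. Qed.

Lemma inclK a : retract (incl a) = a.
Proof.
move: a; apply: free_hom_ext => // [a b|c]; first by rewrite inclD /retract free_liftD.
by rewrite /incl free_map_gen /retract free_lift_gen eK.
Qed.

Lemma shiftD a p q : shift a (p + q) = shift a p + shift a q.
Proof. exact: free_mapD. Qed.

Lemma shift_add a b p : shift (a + b) p = shift a (shift b p).
Proof.
rewrite /shift free_map_comp; congr free_map.
by apply: funext => s; congr (_, _); rewrite gA.
Qed.

Lemma shift0 p : shift 0 p = p.
Proof. by apply: free_map_id => -[a v]; congr (_, _); rewrite g0l. Qed.

Lemma conj_lift_shift a p : conj_lift (shift a p) = incl a + conj_lift p - incl a.
Proof.
move: p; apply: free_hom_ext => [p q|p q|s].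
- by rewrite shiftD /conj_lift free_liftD.
- by rewrite /conj_lift free_liftD !Defs.gsimp.
- rewrite /shift free_map_gen /conj_lift !free_lift_gen /conj_gen inclD.
  by rewrite !Defs.gsimp.
Qed.

(** The pair (p, a) stands for [conj_lift p + incl a]. By [conj_lift_shift], moving [incl a] to the
    right past [conj_lift q] turns q into [shift a q], which dictates this sum. *)
Definition sd_add (x y : P * free_group U) := (x.1 + shift x.2 y.1, x.2 + y.2).
Definition sd_opp (x : P * free_group U) := (shift (- x.2) (- x.1), - x.2).

Lemma sd_groupP : is_group sd_add (0, 0) sd_opp.
Proof.
have S0 a : shift a 0 = 0 by apply: additive0; exact: shiftD.
split.
- by move=> x y z; rewrite /sd_add /= shiftD shift_add !gA.
- by move=> [p a]; rewrite /sd_add /= shift0 !g0l.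
- by move=> [p a]; rewrite /sd_add /= S0 !g0r.
- by move=> [p a]; rewrite /sd_add /= -shiftD !gNl S0.
- by move=> [p a]; rewrite /sd_add /= -shift_add !gNr shift0 gNr.
Qed.

Definition sd_group : group := Defs.Group sd_groupP.

Lemma sd_addE (x y : sd_group) : x + y = (x.1 + shift x.2 y.1, x.2 + y.2).
Proof. by []. Qed.

Lemma sd_oppE (x : sd_group) : - x = (shift (- x.2) (- x.1), - x.2).
Proof. by []. Qed.

(** This is the inverse of (p, a) -> [conj_lift p + incl a]; a letter v of V is its own conjugate by
    0. *)
Definition split : free_group T -> sd_group :=
  free_lift (fun c => match d c return sd_group with
    | inl u => (0, free_gen u)
    | inr v => (free_gen (0, v), 0)
    end).

Lemma splitD g h : split (g + h) = split g + split h.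
Proof. exact: free_liftD. Qed.

Lemma splitK g : conj_lift (split g).1 + incl (split g).2 = g.
Proof.
move: g; apply: free_hom_ext => // [g h|c].
  rewrite splitD sd_addE /= /conj_lift free_liftD -/conj_lift conj_lift_shift inclD.
  by rewrite !Defs.gsimp.
rewrite /split free_lift_gen; case ec: (d c) => [u|v] /=.
  by rewrite /conj_lift free_lift0 g0l /incl free_map_gen -ec dK.
by rewrite /conj_lift free_lift_gen /conj_gen /= -ec dK !Defs.gsimp.
Qed.

Lemma split2 g : (split g).2 = retract g.
Proof.
move: g; apply: free_hom_ext => [g h|g h|c].
- by rewrite splitD.
- exact: free_liftD.
- by rewrite /split /retract !free_lift_gen; case: (d c).
Qed.

Lemma split_incl a : split (incl a) = (0, a).
Proof.
move: a; apply: (@free_hom_ext U sd_group (split \o incl) (fun a => (0, a))).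
- by move=> a b /=; rewrite inclD splitD.
- by move=> a b; rewrite sd_addE /= (additive0 (shiftD a)) g0l.
- by move=> c; rewrite /= /incl free_map_gen /split free_lift_gen eK.
Qed.

Lemma split_conj_lift p : split (conj_lift p) = (p, 0).
Proof.
move: p; apply: (@free_hom_ext _ sd_group (split \o conj_lift) (fun p => (p, 0))).
- by move=> p q; rewrite /= /conj_lift free_liftD splitD.
- by move=> p q; rewrite sd_addE /= shift0 g0l.
- move=> [a v]; rewrite /= /conj_lift free_lift_gen /conj_gen !splitD.
  rewrite (additiveN splitD) split_incl /split free_lift_gen eK /=.
  rewrite !sd_addE sd_oppE /= gN0 !(additive0 (shiftD _)) !Defs.gsimp.
  (* What remains is that translating the index (0, v) by a gives (a, v). *)
  by rewrite /shift free_map_gen /= g0r.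
Qed.

Lemma conj_lift_inj : injective conj_lift.
Proof. by move=> p q /(congr1 split); rewrite !split_conj_lift => -[]. Qed.

Lemma retract_ker g : retract g = 0 -> exists p, g = conj_lift p.
Proof.
move=> rg; exists (split g).1.
by rewrite -{1}[g]splitK split2 rg (additive0 inclD) g0r.
Qed.

End RetractionKernel.

(** * Skew brace homomorphisms and the right series *)

Section BraceMaps.
Variables (B C : skew_brace) (f : B -> C).
Hypothesis hf : is_brace_hom f.

Let fD : forall x y, f (x + y) = f x + f y. Proof. exact: hf.1. Qed.

Lemma brace_hom_lambda a b : f (lambda a b) = lambda (f a) (f b).
Proof. by rewrite /lambda fD (additiveN fD) hf.2. Qed.

Lemma brace_hom_star a b : f (star a b) = star (f a) (f b).
Proof. by rewrite /star fD (additiveN fD) brace_hom_lambda. Qed.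

Lemma brace_hom_cinv a : f (cinv a) = cinv (f a).
Proof. by apply/esym/cV_uniq; rewrite -hf.2 cVr !cone0 (additive0 fD). Qed.

Lemma brace_hom_series k x : right_series B k x -> right_series C k (f x).
Proof.
rewrite /right_series; elim: k.-1 x => //= j IHj x.
elim=> {x}[x [a [b [Ia ->]]]||x y _ hx _ hy|x _ hx].
- apply: generated_in; exists (f a), (f b).
  by split; [exact: IHj | exact: brace_hom_star].
- by rewrite (additive0 fD); exact: generated0.
- by rewrite fD; exact: generatedD.
- by rewrite (additiveN fD); exact: generatedN.
Qed.

End BraceMaps.

(** The indices 0 and 1 both denote the whole brace, so the recursion only starts at [k = 1]. *)
Lemma right_seriesS (B : skew_brace) k : (0 < k)%N ->
  right_series B k.+1
  = generated [set x | exists a b, right_series B k a /\ x = star a b].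
Proof. by case: k. Qed.

(** * Evaluation of symbols in a skew brace *)

Definition circ_group (B : skew_brace) : group := Defs.Group (circP B).

Definition circ_letter (B : skew_brace) (l : B * bool) : B :=
  if l.2 then cinv l.1 else l.1.

Lemma brace_hom_letter (B C : skew_brace) (f : B -> C) l : is_brace_hom f ->
  f (circ_letter l) = circ_letter (f l.1, l.2).
Proof. by case: l => c [] hf //; rewrite /circ_letter /= brace_hom_cinv. Qed.

Lemma circ_letterVr (B : skew_brace) (l : B * bool) :
  circ_letter l ∘ circ_letter (letter_inv l) = cone.
Proof. by case: l => c []; rewrite /circ_letter /= ?cVl ?cVr. Qed.

(* The value of x_{f,t}, from the values [w] of the letters of f and the value
   [t] of its second index: if f = a_1 ∘ ... ∘ a_k, this is
   lambda_{a_1 ∘ ... ∘ a_(k-1)}(a_k * t). *)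
Fixpoint node_eval (B : skew_brace) (w : seq B) (t : B) : B :=
  if w is a :: w' then
    if w' is [::] then star a t else lambda a (node_eval w' t)
  else 0.

Section Evaluation.
Variables (X : Type) (B : skew_brace) (f : X -> B).

Fixpoint eval_symbol (s : symbol X) : B :=
  match s with
  | Gen x => f x
  | Node w t =>
      node_eval [seq circ_letter (eval_symbol l.1, l.2) | l <- w] (eval_symbol t)
  end.

Definition eval_letter (l : symbol X * bool) : B :=
  circ_letter (eval_symbol l.1, l.2).

Definition eval_node w t := node_eval (map eval_letter w) (eval_symbol t).

Lemma eval_letterVr l : eval_letter l ∘ eval_letter (letter_inv l) = cone.
Proof. exact: circ_letterVr. Qed.

(** Mirrors rule (ii) for lambda on generators. If [a] cancels the head of [w], the lambdas of the
    two letters compose to the identity. The excluded word is the one whose cancelled letter enters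
    through [star]; it belongs to rule (iii). *)
Lemma eval_node_push a w t : (0 < size w)%N -> w <> [:: letter_inv a] ->
  eval_node (push a w) t = lambda (eval_letter a) (eval_node w t).
Proof.
case: w => // l w _ ne /=; case: asboolP => [e|//]; subst l.
case: w ne => [//|m w] _; rewrite /eval_node /= -lambdaM eval_letterVr lambda1.
by [].
Qed.

End Evaluation.

Lemma wf_symbol_Node (X : Type) w (t : symbol X) :
  wf_symbol (Node w t) =
  [&& 0 < size w, reduced w,
      all (fun l => wf_symbol l.1 && (level l.1 <= last_level w)) w,
      wf_symbol t & level t <= last_level w].
Proof. by []. Qed.

Lemma level_Node (X : Type) w (t : symbol X) :
  level (Node w t) = (last_level w).+1.
Proof. by []. Qed.

(** Induction on the level: in a well-formed node, the letters and the second index have level at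
    most that of the last letter, hence below that of the node. *)
Lemma brace_hom_eval (X : Type) (B C : skew_brace) (i : X -> B) (f : X -> C)
    (phi : B -> C) s : is_brace_hom phi -> (forall x, phi (i x) = f x) ->
  wf_symbol s -> phi (eval_symbol i s) = eval_symbol f s.
Proof.
move=> hphi e; have [k] := ubnP (level s).
elim: k s => // k IHk [x|w t] /=; first by rewrite e.
rewrite ltnS -/(last_level w) => wk /and5P[_ _ wf wt tw].
have {tw} <- := IHk t (leq_ltn_trans tw wk) wt.
have {wf} : all (fun l => wf_symbol l.1 && (level l.1 < k)) w.
  by apply: sub_all wf => l /andP[-> /leq_ltn_trans]; apply.
elim: w {wk} => [_|l w IHw]; first exact: additive0 hphi.1.
rewrite [all _ _]/= => /andP[/andP[wl lk] /IHw{}IHw].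
have el : phi (circ_letter (eval_symbol i l.1, l.2))
    = circ_letter (eval_symbol f l.1, l.2).
  by rewrite brace_hom_letter // IHk.
case: w IHw => [|m w] IHw; first by rewrite /= brace_hom_star // el.
by rewrite /= in IHw *; rewrite brace_hom_lambda // IHw el.
Qed.

(** The last letter of the word fixes the level: its [star] with the second index climbs one step in
    the series, and the letters before it act by lambda, which preserves ideals. *)
Lemma eval_symbol_level (X : Type) (B : skew_brace) (f : X -> B) s :
  wf_symbol s -> right_series B (level s) (eval_symbol f s).
Proof.
have [k] := ubnP (level s); elim: k s => // k IHk [x|w t] //.
rewrite [level _]/= ltnS -/(last_level w) => wk /= /and5P[sw _ wf _ _].
have gt0 (s : symbol X) : (0 < level s)%N by case: s.
elim: w sw wk wf => // l w IHw _.
case: w IHw => [_|m w IHw] lk /andP[/andP[wl _] wf].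
  rewrite right_seriesS; last exact: gt0.
  apply: generated_in; do 2 eexists; split; last by [].
  rewrite /circ_letter; case: (l.2); last exact: IHk.
  by apply/(ideal_cinv (right_series_ideal B _))/IHk.
have {}IHw := IHw isT lk wf.
exact: (ideal_lambda (right_series_ideal B _)).
Qed.

Lemma right_nilpotent_lambda (C : skew_brace) n a b :
  right_nilpotent n C -> right_series C n a -> lambda a b = b.
Proof.
case: n => [|m] nil ha.
  (* For class 0 the index 0 of the series gives no information on [a], but C^(1) = 0 makes C
     zero. *)
  have z (x : C) : x = 0 by have : right_series C 1 x by []; rewrite nil.
  by rewrite (z b) (z (lambda a 0)).
have : right_series C m.+2 (star a b).
  by rewrite right_seriesS //; apply: generated_in; exists a, b.
by rewrite nil /= => h; rewrite -[LHS](gNK _ b) -starE h g0l.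
Qed.

Lemma alphabetP (X : Type) n (s : symbol X) :
  wf_symbol s -> level s <= n -> exists c : alphabet X n, val c = s.
Proof.
move=> ws ls; have h : wf_symbol s && (level s <= n) by rewrite ws.
by exists (exist _ s h).
Qed.

(** * The universal property of the realisation *)

Section FreeObject.
Variables (X : Type) (n : nat).
Let A := alphabet X n.
Let F := free_group A.
Let B := free_right_nilpotent X n.

Section Existence.
Variables (C : skew_brace) (f : X -> C).
Hypothesis nilC : right_nilpotent n C.

Definition free_eval : B -> C :=
  @free_lift A C (fun c => eval_symbol f (val c)).

(** Lifting to [circ_group C] makes the map multiplicative on F_o(A_n); [free_eval_cocycle] compares
    it with the additive lift. *)
Definition circ_eval : F -> C :=
  @free_lift A (circ_group C) (fun c => eval_symbol f (val c)).

Lemma circ_evalM u v : circ_eval (u + v) = circ_eval u ∘ circ_eval v.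
Proof. exact: (@free_liftD A (circ_group C)). Qed.

Lemma circ_eval_letter l : circ_eval (free_letter l) = eval_letter f (symbol_letter l).
Proof. exact: (@free_lift_letter A (circ_group C)). Qed.

Lemma free_evalD (g h : F) : free_eval (g + h) = free_eval g + free_eval h.
Proof. exact: free_liftD. Qed.

Lemma free_eval_gen c : free_eval (free_gen c) = eval_symbol f (val c).
Proof. exact: free_lift_gen. Qed.

(** Each branch of [lambda_gen] is an identity in C. Letters of level n act trivially by nilpotency;
    (i) is lambda_a(b) = a * b + b; (ii) is [eval_node_push]; (iii) is lambda_a(a' * t) = t -
    lambda_a(t) = -(a * t), with a' the inverse of a. *)
Lemma free_eval_lambda_gen l b :
  free_eval (lambda_gen l b)
  = lambda (eval_letter f (symbol_letter l)) (eval_symbol f (val b)).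
Proof.
have [ln|/negbTE/lev_neq ln] := eqVneq (symbol_level l.1) n.
  rewrite lambda_gen1 // free_eval_gen (right_nilpotent_lambda _ nilC) //.
  have : right_series C n (eval_symbol f (val l.1)).
    by rewrite -{1}ln; apply: eval_symbol_level; have /andP[] := valP l.1.
  rewrite /eval_letter /circ_letter /=; case: l.2 => // h.
  exact: (ideal_cinv (right_series_ideal C n)).
have [bl|lb] := leqP (symbol_level b) (symbol_level l.1).
  have [x ex] := symbol2P ln bl.
  rewrite (lambda_gen2 ln bl ex) free_evalD !free_eval_gen ex.
  by rewrite -/(eval_node f _ _) /eval_node /= starE gNK.
have [w [t [eb rw sw h1 h2]]] := symbol3P lb.
have [ew|nw] := pselect (w = [:: letter_inv (symbol_letter l)]).
  have [x [ex lx]] := h1 ew; subst w.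
  rewrite (lambda_gen3 lb eb ex) (additiveN free_evalD) free_eval_gen ex eb.
  rewrite -![eval_symbol f (Node _ _)]/(eval_node f _ _) /eval_node /=.
  by rewrite !starE lambdaD lambdaN -lambdaM eval_letterVr lambda1 !Defs.gsimp.
have [x [ex lx]] := h2 nw.
rewrite (lambda_gen4 lb eb nw ex) free_eval_gen ex eb.
exact: eval_node_push.
Qed.

Lemma free_eval_lambda_letter l g :
  free_eval (lambda_letter l g)
  = lambda (eval_letter f (symbol_letter l)) (free_eval g).
Proof.
move: g; apply: free_hom_ext => [g h|g h|c].
- by rewrite lambda_letterD free_evalD.
- by rewrite free_evalD lambdaD.
- by rewrite lambda_letter_gen free_eval_lambda_gen free_eval_gen.
Qed.

(** Both sides obey the same recursion along the word, since a ∘ b = a + lambda_a(b) in C; on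
    inverse letters [cocycle_letter] has the shape of [cinvE]. *)
Lemma free_eval_cocycle u : free_eval (cocycle u) = circ_eval u.
Proof.
move: u; apply: free_ind => [|[c s] u IHu]; first exact: (esym (@cone0 C)).
rewrite cocycle_cons circ_evalM circ_eval_letter circE free_evalD.
rewrite free_eval_lambda_letter IHu; congr (_ + _).
rewrite /cocycle_letter; case: s; last exact: free_eval_gen.
rewrite (additiveN free_evalD) free_eval_lambda_letter free_eval_gen.
by rewrite /eval_letter /circ_letter /= -cinvE.
Qed.

Lemma free_eval_hom : is_brace_hom free_eval.
Proof.
split=> [|a b]; first exact: free_evalD.
by rewrite [LHS]free_eval_cocycle circ_evalM -!free_eval_cocycle !cocycle_invK.
Qed.

End Existence.

(** The cocycle identity pi(u ∘ v) = pi(u) + lambda_u(pi(v)), taken at pi(v) = g. *)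
Lemma lambda_freeE (u g : F) : lambda (cocycle u : B) g = lambda_word u g.
Proof.
by rewrite lambdaE /= /free_circ cocycleM cocycleK cocycle_invK !Defs.gsimp.
Qed.

Lemma circ_letter_freeE (l : A * bool) :
  circ_letter (free_gen l.1 : B, l.2) = cocycle (free_letter l).
Proof.
case: l => c []; last exact: (esym (cocycle_gen c)).
by rewrite /circ_letter /= /free_cinv -{1}(cocycle_gen c) cocycleK free_genN.
Qed.

Lemma lambda_letter_freeE (l : A * bool) (g : F) :
  lambda (circ_letter (free_gen l.1 : B, l.2)) g = lambda_letter l g.
Proof. by rewrite circ_letter_freeE lambda_freeE. Qed.

Section Generators.
Variable i : X -> B.
Hypothesis iE : forall x (c : A), val c = Gen x -> i x = free_gen c.

(** This is why X generates B: rules (i) and (ii), read backwards, express each symbol by lambda and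
    [star] through symbols of lower level. *)
Lemma eval_symbol_free (c : A) : eval_symbol i (val c) = free_gen c.
Proof.
have [k] := ubnP (level (val c)).
elim: k c => // k IHk c; case ec: (val c) => [x|w t]; first by rewrite -(iE ec).
have := valP c; rewrite ec wf_symbol_Node level_Node ltnS.
move=> /andP[/and5P[sw rw wf wt tw] wn] wk.
have [b eb] := alphabetP wt (leq_trans tw (ltnW wn)).
rewrite -[LHS]/(eval_node i w t) /eval_node.
rewrite -eb in ec tw *; rewrite IHk; last exact: leq_ltn_trans tw wk.
clear t eb wt.
(* Inner induction on the word, for every symbol [c] carrying it, with the second index [b]
   fixed. *)
move: c ec.
elim: w sw rw wf tw wn wk => // l w IHw _ rw /= /andP[/andP[wl ll] wf] bw wn wk c ec.
have [a ea] : exists a : A * bool, symbol_letter a = l.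
  have [c0 e] := alphabetP wl (leq_trans ll (ltnW wn)).
  by exists (c0, l.2); rewrite [RHS]surjective_pairing -e.
have el : eval_symbol i l.1 = free_gen a.1.
  have e : l.1 = val a.1 by rewrite -ea.
  by rewrite e IHk // -e (leq_ltn_trans ll wk).
have -> : eval_letter i l = circ_letter (free_gen a.1 : B, a.2).
  by rewrite /eval_letter el -ea.
have la : symbol_level a.1 <= last_level (l :: w).
  by rewrite /symbol_level -[val a.1]/(symbol_letter a).1 ea.
rewrite -ea in ec la bw *.
case: w IHw rw wf bw wn wk ll ec la => [|m w] IHw rw wf bw wn wk ll ec la.
  (* One letter: rule (i) gives a * b = (x_{a,b} + b) - b. *)
  rewrite starE lambda_letter_freeE lambda_letter_gen.
  rewrite (lambda_gen2 _ bw ec) ?gK //.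
  by rewrite -[symbol_level _]/(level (symbol_letter a).1) ea.
(* Dropping the first letter keeps the last one, hence the level, so the shorter word still indexes
   a symbol of A_n. As the word is reduced, rule (ii) puts the letter back without cancellation. *)
move: rw; rewrite reduced_cons => /andP[/asboolP nm rw].
have [c' ec'] : exists c' : A, val c' = Node (m :: w) (val b).
  apply: alphabetP => //; rewrite wf_symbol_Node rw.
  by apply/and5P; split=> //; have /andP[] := valP b.
rewrite /= in IHw *; rewrite (IHw isT rw wf bw wn wk c' ec').
rewrite lambda_letter_freeE lambda_letter_gen.
apply: (lambda_gen4 _ ec' _ _); first by rewrite /symbol_level ec' ltnS.
  by rewrite ea => -[].
by apply: (etrans ec); rewrite /= asboolF // ea.
Qed.

(** An additive map is determined by its values on the generators; these are evaluations of symbols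
    in B, which homomorphisms preserve. *)
Lemma free_brace_hom_uniq (C : skew_brace) (f : X -> C) (psi : B -> C) :
  is_brace_hom psi -> (forall x, psi (i x) = f x) -> psi = free_eval f.
Proof.
move=> hpsi e; apply: funext; apply: free_hom_ext; [exact: hpsi.1|exact: free_evalD|].
move=> c; rewrite free_eval_gen -eval_symbol_free.
by apply: brace_hom_eval => //; have /andP[] := valP c.
Qed.

Lemma free_gen_series (c : A) : right_series B (symbol_level c) (free_gen c).
Proof.
by rewrite -eval_symbol_free; apply: eval_symbol_level; have /andP[] := valP c.
Qed.

End Generators.

End FreeObject.

(* Equal to 0 when [n = 0], since then A_n is empty. *)
Definition free_inj (X : Type) (n : nat) (x : X) : free_right_nilpotent X n :=
  if insub (Gen x) is Some c then free_gen (c : alphabet X n) else 0.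

Lemma free_injE (X : Type) n x (c : alphabet X n) :
  val c = Gen x -> free_inj n x = free_gen c.
Proof. by rewrite /free_inj => <-; rewrite valK. Qed.

Lemma lambda0l (B : skew_brace) (b : B) : lambda 0 b = b.
Proof. by rewrite -cone0 lambda1. Qed.

Lemma right_nilpotentP (B : skew_brace) n :
  (forall x, right_series B n.+1 x -> x = 0) -> right_nilpotent n B.
Proof.
move=> h; apply/seteqP; split=> x; first exact: h.
by move=> ->; exact: ideal0 (right_series_ideal B _).
Qed.

Lemma right_nilpotentS (B : skew_brace) n :
  (forall a b, right_series B n.+1 a -> lambda a b = b) -> right_nilpotent n.+1 B.
Proof.
move=> h; apply: right_nilpotentP => x; rewrite right_seriesS //.
elim=> {x}[x [a [b [ha ->]]]|//|x y _ -> _ ->|x _ ->]; rewrite ?starE ?h //.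
- exact: gNr.
- exact: g0l.
- exact: gN0.
Qed.

(** * Truncation to A_m, and right nilpotency of the realisation by induction *)

Section TopLevel.
Variables (X : Type) (m : nat).
Let A := alphabet X m.+1.
Definition top_symbol := {c : A | symbol_level c == m.+1}.

(** With its inverse [symbol_split], this is the decomposition of A_(m+1) into A_m and X^(m+1). *)
Definition symbol_join (s : alphabet X m + top_symbol) : A :=
  match s with
  | inl c => alphabet_incl (leqnSn m) c
  | inr c => val c
  end.

Lemma symbol_join_surj (c : A) : exists s, symbol_join s = c.
Proof.
have [h|h] := boolP (symbol_level c == m.+1); first by exists (inr (exist _ c h)).
have /andP[wc lc] := valP c.
have [|b eb] := @alphabetP X m (val c) wc; last by exists (inl b); apply: val_inj.
by rewrite -ltnS ltn_neqAle lc andbT.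
Qed.

Definition symbol_split (c : A) := sval (cid (symbol_join_surj c)).

Lemma symbol_splitK : cancel symbol_split symbol_join.
Proof. by move=> c; exact: svalP (cid (symbol_join_surj c)). Qed.

Lemma symbol_join_inj : injective symbol_join.
Proof.
have low (a : alphabet X m) : symbol_level (alphabet_incl (leqnSn m) a) != m.+1.
  by rewrite ltn_eqF // ltnS; exact: lev_le a.
move=> [a|a] [b|b] /= e.
- by congr inl; apply: val_inj; exact: (congr1 (@sval _ _) e).
- by have := low a; rewrite e (valP b).
- by have := low b; rewrite -e (valP a).
- by congr inr; exact: val_inj.
Qed.

Lemma symbol_joinK : cancel symbol_join symbol_split.
Proof. by move=> s; apply: symbol_join_inj; rewrite symbol_splitK. Qed.

(** Only the type differs from [retract symbol_split]: this form is kept for elements of the braces,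
    the other one for words of F_o(A_(m+1)). *)
Definition truncate : free_right_nilpotent X m.+1 -> free_right_nilpotent X m :=
  retract symbol_split.

(** Such a word is a product of conjugates of letters of level m + 1 and their inverses, and letters
    of that level act as the identity. *)
Lemma truncate_ker_lambda (u g : free_group A) :
  retract symbol_split u = 0 -> lambda_word u g = g.
Proof.
move=> /(retract_ker symbol_splitK)[p ->]; move: p g.
apply: free_ind => [g|[[a c] s] p IHp g]; first exact: lambda_word0.
have cl : forall g, lambda_word (free_gen (val c)) g = g.
  move=> {}g; rewrite lambda_word_letter; move: g; apply: free_hom_ext => //.
    by move=> g h; rewrite lambda_letterD.
  by move=> b; rewrite lambda_letter_gen lambda_gen1 //; exact/eqP/(valP c).
rewrite /conj_lift free_liftD lambda_wordM IHp free_lift_letter /letter_eval.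
have L h : lambda_word (conj_gen symbol_join (a, c)) h = h.
  by rewrite /conj_gen !lambda_wordM cl lambda_wordK.
by case: s => //=; rewrite -{1}[g]L lambda_wordVK.
Qed.

Section Step.
Let B := free_right_nilpotent X m.+1.
Let C := free_right_nilpotent X m.
Hypothesis nilC : right_nilpotent m C.

Lemma truncateD (g h : B) : truncate (g + h) = truncate g + truncate h.
Proof. exact: free_liftD. Qed.

(** Evaluation fixes the symbols of A_m by [eval_symbol_free] and sends those of level m + 1 into
    C^(m+1) = 0. This is how the retraction is seen to respect ∘. *)
Lemma truncate_eval : truncate = free_eval (free_inj m).
Proof.
apply: funext; apply: free_hom_ext; [exact: truncateD|exact: free_evalD|] => c.
rewrite free_eval_gen /truncate /retract free_lift_gen -{2}(symbol_splitK c).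
case: (symbol_split c) => a /=.
  by rewrite (eval_symbol_free (@free_injE X m)).
have : right_series C m.+1 (eval_symbol (free_inj m) (val (val a))).
  rewrite -{1}(eqP (valP a)); apply: eval_symbol_level.
  by have /andP[] := valP (val a).
by rewrite nilC.
Qed.

Lemma truncate_hom : is_brace_hom truncate.
Proof.
(* Evaluating A_(m+1) requires the target to have class m + 1; class m implies it, because
   [lambda 0] is the identity. *)
rewrite truncate_eval; apply: free_eval_hom; apply: right_nilpotentS => a b.
by rewrite nilC => ->; exact: lambda0l.
Qed.

(** Both sides are homomorphisms from F_o(A_(m+1)) to the multiplicative group of C that agree on
    letters. *)
Lemma truncate_cocycle (u : free_group A) :
  truncate (cocycle u) = cocycle (retract symbol_split u).
Proof.
move: u; apply: (@free_hom_ext _ (circ_group C) (truncate \o @cocycle X m.+1)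
  (@cocycle X m \o retract symbol_split)) => [u v|u v|c] /=.
- rewrite -[RHS]truncate_hom.2; congr truncate.
  by rewrite /= /free_circ !cocycleK.
- rewrite [retract _ _]free_liftD.
  by rewrite [RHS]/(free_circ _ _) /free_circ !cocycleK.
- rewrite cocycle_gen /truncate /retract free_lift_gen.
  by case: (symbol_split c) => a //; rewrite cocycle_gen.
Qed.

(** Injectivity of the cocycle of C carries the kernel condition from [g] over to its word in
    F_o(A_(m+1)), where [truncate_ker_lambda] applies. *)
Lemma truncate_lambda (g h : B) : truncate g = 0 -> lambda g h = h.
Proof.
rewrite -(cocycle_invK g) => r; rewrite lambda_freeE; apply: truncate_ker_lambda.
by apply: cocycle_inj; rewrite -truncate_cocycle r.
Qed.

Lemma truncate_series (g : B) : right_series B m.+1 g -> truncate g = 0.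
Proof. by move/(brace_hom_series truncate_hom); rewrite nilC. Qed.

Lemma free_right_nilpotentS : right_nilpotent m.+1 B.
Proof. by apply: right_nilpotentS => a b /truncate_series/truncate_lambda. Qed.

End Step.
End TopLevel.

Lemma free_right_nilpotentP (X : Type) n :
  right_nilpotent n (free_right_nilpotent X n).
Proof.
elim: n => [|m IHm]; last exact: free_right_nilpotentS.
(* Levels are at least 1, so A_0 is empty and the brace is zero. *)
by apply: right_nilpotentP => g _; exact: high_top (high1 g).
Qed.

Lemma free_right_nilpotent_free (X : Type) n : (0 < n)%N ->
  is_free_right_nilpotent n (@free_inj X n).
Proof.
move=> n_gt0; split=> [|C f nilC]; first exact: free_right_nilpotentP.
exists (free_eval f); split; first exact: free_eval_hom.
  move=> x; have [|c ec] := @alphabetP X n (Gen x) isT; first exact: n_gt0.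
  by rewrite (free_injE ec) free_eval_gen ec.
by move=> psi hpsi e; exact: (free_brace_hom_uniq (@free_injE X n) hpsi e).
Qed.

Lemma inj_surj_bij (T U : Type) (f : T -> U) :
  injective f -> (forall y, exists x, f x = y) -> bijective f.
Proof.
move=> fi fs; exists (fun y => sval (cid (fs y))) => [x|y].
  by apply: fi; exact: svalP (cid (fs (f x))).
exact: svalP (cid (fs y)).
Qed.

(** * The ideal B^(m+1): quotient, generators, triviality and free basis *)

Section LastTerm.
Variables (X : Type) (m : nat).
Let B := free_right_nilpotent X m.+1.
Let C := free_right_nilpotent X m.
Let hB := right_series_ideal B m.+1.

Lemma conj_gen_series s : right_series B m.+1 (conj_gen (@symbol_join X m) s).
Proof.
case: s => a c; apply: (ideal_conj hB).
by have := free_gen_series (@free_injE X m.+1) (val c); rewrite (eqP (valP c)).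
Qed.

(** Replaces membership in an iterated generated subgroup by one equation; all four claims rest on
    it. *)
Lemma truncate_kerP (g : B) :
  right_series B m.+1 g <-> truncate g = 0.
Proof.
split; first exact: (truncate_series (@free_right_nilpotentP X m)).
move=> /(retract_ker (@symbol_splitK X m))[p ->]; move: p.
apply: free_ind => [|l p IHp]; first exact: ideal0 hB.
rewrite /conj_lift free_liftD; apply: (idealD hB) => //.
rewrite free_lift_letter /letter_eval.
by case: l.2; first apply: (idealN hB); exact: conj_gen_series.
Qed.

Lemma quotient_isomorphic : isomorphic (quotient_brace hB) C.
Proof.
have hT := truncate_hom (@free_right_nilpotentP X m).
(* The value on a coset does not depend on the chosen representative. *)
have tE a : truncate (quotient_repr (quotient_proj (right_series B m.+1) a)) = truncate a.
  have [x /truncate_kerP x0 ->] := quotient_projK hB a.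
  by rewrite truncateD x0 g0r.
exists (fun S => truncate (quotient_repr S)); split.
  by split=> S T; rewrite tE ?hT.1 ?hT.2.
apply: inj_surj_bij => [S T e|g].
  rewrite -(quotient_reprK S) -(quotient_reprK T); apply/(quotient_projP hB).
  exists (- quotient_repr S + quotient_repr T); last by rewrite !Defs.gsimp.
  by apply/truncate_kerP; rewrite truncateD (additiveN (@truncateD X m)) e gNl.
exists (@quotient_proj B _ (incl (@symbol_join X m) g)).
by rewrite tE; apply: inclK; exact: symbol_joinK.
Qed.

Lemma last_term_generated :
  right_series B m.+1 = generated
    [set g : B | exists (a : free_group (alphabet X m.+1)) (b : alphabet X m.+1),
       symbol_level b = m.+1 /\ g = a + free_gen b - a].
Proof.
apply/seteqP; split=> g; last first.
  elim=> {g}[g [a [b [hb ->]]]||g h _ hg _ hh|g _ hg].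
  - apply: (ideal_conj hB); rewrite -{1}hb.
    exact: free_gen_series (@free_injE X m.+1) b.
  - exact: ideal0 hB.
  - exact: (idealD hB).
  - exact: (idealN hB).
move/truncate_kerP/(retract_ker (@symbol_splitK X m)) => [p ->]; move: p.
apply: free_ind => [|l p IHp]; first exact: generated0.
rewrite /conj_lift free_liftD; apply: generatedD => //.
rewrite free_lift_letter /letter_eval.
by case: l.2; first apply: generatedN; apply: generated_in;
  case: l.1 => a c; exists (incl (@symbol_join X m) a), (val c);
  split=> //; apply/eqP; exact: valP c.
Qed.

Lemma last_term_trivial : is_trivial (ideal_brace hB).
Proof.
move=> [g hg] [h hh]; apply: ideal_val_inj; rewrite -[LHS]/((g : B) ∘ h) circE.
rewrite (truncate_lambda (@free_right_nilpotentP X m)) //.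
exact/truncate_kerP.
Qed.

(** The basis is a set of elements, whereas [conj_lift] is indexed by pairs (a, c). The map [q] from
    pairs to elements, with section [t], carries the injectivity and the image of [conj_lift]
    over. *)
Lemma last_term_basis : is_free_basis (G := ideal_brace hB)
  [set g : ideal_brace hB |
     exists (a : free_group (alphabet X m)) (b : alphabet X m.+1),
       symbol_level b = m.+1 /\
       sval g = free_map (alphabet_incl (leqnSn m)) a + free_gen b
                - free_map (alphabet_incl (leqnSn m)) a].
Proof.
set S := [set g | _]; pose h (s : {x | S x}) : B := sval (sval s).
(* Along [symbol_join], [incl] unfolds to [free_map] of the inclusion of A_m in A_(m+1), as in
   [S]. *)
have qP (s : free_group (alphabet X m) * top_symbol X m) :
    S (exist _ _ (conj_gen_series s)).
  by exists s.1, (val s.2); split=> //; apply/eqP; exact: valP s.2.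
pose q s : {x | S x} := exist _ _ (qP s).
have tP s : exists t, q t = s.
  case: s => -[g hg] gS; have [a [b [/eqP lb eg]]] := gS.
  exists (a, exist _ b lb).
  have e : exist _ _ (conj_gen_series (a, exist _ b lb)) = exist _ g hg :> ideal_brace hB.
    by apply: ideal_val_inj; rewrite [RHS]eg.
  rewrite /q; move: (qP _); rewrite e => p; congr exist; exact: Prop_irrelevance.
pose t s := sval (cid (tP s)).
have tK s : q (t s) = s := svalP (cid (tP s)).
have hE w : sval (free_lift (G := ideal_brace hB) (fun s => sval s) w)
    = free_lift (G := B) h w.
  move: w; apply: free_hom_ext => [x y|x y|s].
  - by rewrite free_liftD.
  - exact: free_liftD.
  - by rewrite !free_lift_gen.
have liftE w : conj_lift (@symbol_join X m) w = free_lift (G := B) h (free_map q w).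
  by rewrite free_lift_map.
apply: inj_surj_bij => [u v /(congr1 (@sval _ _))|[g hg]].
  (* Every word in elements of [S] comes from a word in pairs, on which [conj_lift] is injective. *)
  have mapK w : free_map q (free_map t w) = w.
    by rewrite free_map_comp free_map_id.
  rewrite !hE -(mapK u) -(mapK v) -!liftE.
  by move/(conj_lift_inj (@symbol_joinK X m)) => ->.
have [p ep] := retract_ker (@symbol_splitK X m) ((truncate_kerP g).1 hg).
by exists (free_map q p); apply: ideal_val_inj; rewrite hE -liftE -ep.
Qed.

End LastTerm.

Theorem corollary4p16 (n : nat) (hn : 2 <= n) (X : Type) (hX : inhabited X) :
  let B := free_right_nilpotent X n in
  let Bn := right_series B n in
  let hBn := right_series_ideal B n in
  [/\ exists (F : skew_brace) (i : X -> F),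
        is_free_right_nilpotent n.-1 i /\ isomorphic (quotient_brace hBn) F,
      Bn = generated
        [set g : B | exists (a : free_group (alphabet X n)) (b : alphabet X n),
           symbol_level b = n /\ g = a + free_gen b - a],
      is_trivial (ideal_brace hBn)
    & is_free_basis (G := ideal_brace hBn)
        [set g : ideal_brace hBn |
           exists (a : free_group (alphabet X n.-1)) (b : alphabet X n),
             symbol_level b = n /\
             sval g = free_map (alphabet_incl (leq_pred n)) a + free_gen b
                      - free_map (alphabet_incl (leq_pred n)) a]].
Proof.
case: n hn => [//|m] m_gt0 /=; split.
- exists (free_right_nilpotent X m), (@free_inj X m); split.
    (* Here n >= 2 enters: it gives m > 0, so that A_m contains X. *)
    exact: free_right_nilpotent_free.
  exact: quotient_isomorphic.
- exact: last_term_generated.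
- exact: last_term_trivial.
(* The two inclusions of alphabets differ only in the proof of m <= m + 1. *)
- have -> : leq_pred m.+1 = leqnSn m by exact: bool_irrelevance.
  exact: last_term_basis.
Qed.
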